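(* Let $p$ be a polynomial, and let $\mathcal{G}_p$ be the class of finite graphs $G$ such that the number of connected subgraphs of $G$ is at most $p(|G|)$. Suppose $G \in \mathcal{G}_p$ has a colouring $\omega$ from colour-set $C$. Then for any $d \in C$, $m_G(G,\omega,d)$ can be computed in polynomial time, and hence $m_G(G,\omega)$ can also be computed in polynomial time.
   Context: Flood-filling game: a graph $G=(V,E)$ carries a colouring $\omega:V\to C$ (not necessarily proper). A move $(v,d)$ with $v\in V$, $d\in C$ gives colour $d$ to every vertex of the monochromatic component of $v$ (the maximal connected set of vertices containing $v$ all having the same colour as $v$). Moves may be played at any vertex. $m_G(G,\omega,d)$ is the minimum number of moves needed to make every vertex of $G$ have colour $d$, and $m_G(G,\omega)=\min_{d\in C} m_G(G,\omega,d)$. $|G|$ denotes the number of vertices of $G$. *)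

(* Defs.v *)
From HB Require Import structures.
From mathcomp Require Import all_boot all_order all_algebra.
Set Implicit Arguments.
Unset Strict Implicit.
Unset Printing Implicit Defensive.

(** * Finite simple graphs and their connected subgraphs *)

Record sgraph := SGraph {
  vert :> finType;
  adj : rel vert;
  adj_sym : symmetric adj;
  adj_irrefl : irreflexive adj
}.

Definition edges (G : sgraph) : {set {set G}} :=
  [set f : {set G} | [exists u, exists v, adj u v && (f == [set u; v])]].

(* A subgraph (W, F) has vertex set W and edge set F; it need not be induced. *)
Definition is_subgraph (G : sgraph) (H : {set G} * {set {set G}}) : bool :=
  (H.2 \subset edges G) && [forall f in H.2, f \subset H.1].

(* The null graph is not counted as connected. *)
Definition is_connected (G : sgraph) (H : {set G} * {set {set G}}) : bool :=
  (H.1 != set0) &&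
  [forall u in H.1, forall v in H.1,
     connect [rel x y : G | [set x; y] \in H.2] u v].

Definition connected_subgraphs (G : sgraph) :
    {set {set G} * {set {set G}}} :=
  [set H | is_subgraph H && is_connected H].

Definition in_Gp (R : archiRealDomainType) (p : {poly R}) (G : sgraph) : bool :=
  (#|connected_subgraphs G|%:R <= p.[#|G|%:R])%R.

(** * The flood-filling game *)

Section FloodFill.
Variables (G : sgraph) (C : finType).
Implicit Types (w : {ffun G -> C}) (v : G) (d : C) (k : nat).

Definition mono_component w v : {set G} :=
  [set u | connect [rel x y : G | adj x y && (w x == w y)] v u].

Definition flood w (m : G * C) : {ffun G -> C} :=
  [ffun u => if u \in mono_component w m.1 then m.2 else w u].

Definition play w (s : seq (G * C)) : {ffun G -> C} := foldl flood w s.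

Definition floodable_in w d k : bool :=
  [exists s : k.-tuple (G * C), play w s == [ffun => d]].

Lemma flood_stable w m d u : m.2 = d -> w u = d -> flood w m u = d.
Proof. by rewrite ffunE => -> ->; case: ifP. Qed.

Lemma play_const w d (s : seq G) u :
  (u \in s) || (w u == d) -> play w [seq (v, d) | v <- s] u = d.
Proof.
elim: s w => [|v s IHs] w /=; first by move/eqP.
move=> us; apply: IHs; rewrite inE in us.
case/orP: us => [/orP[/eqP-> | ->] | /eqP wu] //.
  by rewrite ffunE /= inE connect0 eqxx orbT.
by rewrite (@flood_stable w (v, d) d) ?eqxx ?orbT.
Qed.

Lemma floodable_exists w d : exists k, floodable_in w d k.
Proof.
exists (size [seq (v, d) | v <- enum G]); apply/existsP.
exists (in_tuple [seq (v, d) | v <- enum G]); apply/eqP/ffunP=> u.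
by rewrite [RHS]ffunE play_const // mem_enum.
Qed.

Definition min_moves_to w d : nat := ex_minn (floodable_exists w d).

Lemma min_moves_exists w :
  0 < #|C| -> exists k, [exists d, min_moves_to w d == k].
Proof.
by case/card_gt0P=> d _; exists (min_moves_to w d); apply/existsP; exists d.
Qed.

Definition min_moves w (C_gt0 : 0 < #|C|) : nat :=
  ex_minn (min_moves_exists w C_gt0).

End FloodFill.

(** * Random access machines *)

(* The Cook-Reckhow RAM: memory cells hold natural numbers, the arithmetic
   instructions are addition and (truncated) subtraction, and each instruction
   takes one step.  Without multiplication, this unit-cost model is polynomially
   equivalent to Turing machines. *)
Inductive instr : Type :=
  | IConst of nat & nat        (* IConst x a :  M[x] := a *)
  | IAdd of nat & nat & nat    (* IAdd x y z :  M[x] := M[y] + M[z] *)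
  | ISub of nat & nat & nat    (* ISub x y z :  M[x] := M[y] - M[z] *)
  | ILoad of nat & nat         (* ILoad x y  :  M[x] := M[M[y]] *)
  | IStore of nat & nat        (* IStore x y :  M[M[x]] := M[y] *)
  | IJpos of nat & nat         (* IJpos x l  :  if M[x] > 0 then goto l *)
  | IRead of nat.              (* IRead x    :  M[x] := next input word, or 0 *)

Definition program := seq instr.

Record config := Config {
  pc : nat;
  mem : nat -> nat;
  input : seq nat
}.

Definition upd (M : nat -> nat) (x a : nat) : nat -> nat :=
  fun y => if y == x then a else M y.

Definition exec (i : instr) (c : config) : config :=
  let M := mem c in
  let next M' := Config (pc c).+1 M' (input c) in
  match i with
  | IConst x a => next (upd M x a)
  | IAdd x y z => next (upd M x (M y + M z))
  | ISub x y z => next (upd M x (M y - M z))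
  | ILoad x y => next (upd M x (M (M y)))
  | IStore x y => next (upd M (M x) (M y))
  | IJpos x l => Config (if 0 < M x then l else (pc c).+1) M (input c)
  | IRead x => Config (pc c).+1 (upd M x (head 0 (input c))) (behead (input c))
  end.

(* The machine halts when the program counter leaves the program. *)
Definition halted (P : program) (c : config) : bool := size P <= pc c.

Definition step (P : program) (c : config) : config :=
  if halted P c then c else exec (nth (IConst 0 0) P (pc c)) c.

Definition init (s : seq nat) : config := Config 0 (fun => 0) s.

(* The total number of binary digits of the input words. *)
Definition input_size (s : seq nat) : nat :=
  \sum_(a <- s) (trunc_log 2 a).+1.

(* Nothing is required of the program on instances x that violate [dom x];
   the answer is left in memory cell 0. *)
Definition poly_time_computable (X : Type) (enc : X -> seq nat)
    (dom : X -> bool) (f : X -> nat) : Prop :=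
  exists (P : program) (q : {poly nat}), forall x, dom x ->
    exists t, let c := iter t (step P) (init (enc x)) in
      [/\ t <= q.[input_size (enc x)]%R, halted P c & mem c 0 = f x].

(** * Flood-filling instances as inputs *)

Record instance := Instance {
  graph : sgraph;
  colour : finType;
  colour_gt0 : 0 < #|colour|;
  colouring : {ffun graph -> colour}
}.

Record target_instance := TargetInstance {
  base :> instance;
  target : colour base
}.

(* Vertices and colours are numbered by their rank.  The input lists the order
   of the graph, the number of colours, the adjacency matrix row by row, the
   colour-set itself, and the colour of each vertex; in particular its size is
   at least |C|. *)
Definition encode (I : instance) : seq nat :=
  [:: #|graph I|; #|colour I|]
    ++ [seq nat_of_bool (adj u v) | u <- enum (graph I), v <- enum (graph I)]
    ++ [seq nat_of_ord (enum_rank c) | c <- enum (colour I)]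
    ++ [seq nat_of_ord (enum_rank (colouring I v)) | v <- enum (graph I)].

Definition encode_target (J : target_instance) : seq nat :=
  encode J ++ [:: nat_of_ord (enum_rank (target J))].

Definition m_target (J : target_instance) : nat :=
  min_moves_to (colouring J) (target J).

Definition m_any (I : instance) : nat :=
  min_moves (colouring I) (colour_gt0 I).

(* Main.v *)
(* For connected sets A, let F(A, d) be the least number of floods turning A into
   colour d inside the subgraph induced by A.  Read backwards, a game is a
   painting: starting from a canvas of colour d, each stroke gives one colour to
   a connected set.  Strokes may overlap arbitrarily, so paintings of disjoint
   sets can be put together; this gives F(A :|: B, d) <= F(A, d) + F(B, d), besides
   F(A, e) <= F(A, d) + 1.  Conversely, floods only merge monochromatic
   components, so that following a game move by move produces a derivation of its
   result from these two rules.  Hence F is the least solution of the two rules,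
   and its values on the polynomially many connected sets are found by n rounds of
   relaxation over all pairs of disjoint connected sets with connected union; the
   answer is the sum of F over the components of G.  On a random access machine, a
   set of vertices is coded by the number with base 4 digits 0 and 1 that
   represents its characteristic function, and codes are used as addresses: since
   adding two codes never carries, the disjointness of A and B and the
   connectedness of their union are tested by looking up code A + code B. *)

Require Import Defs.
From mathcomp Require Import all_boot all_order all_algebra.
From mathcomp Require Import zify.
Set Implicit Arguments.
Unset Strict Implicit.
Unset Printing Implicit Defensive.

(** * Connected sets *)

(** The colour classes met along a game are usually disconnected, while the table can only afford
    connected sets. Derivations therefore live on arbitrary sets, and can be cut along any
    separation at no extra cost. For a connected set with at least two vertices this yields a
    cheapest derivation that ends by joining two smaller connected sets of one colour, followed by
    at most one recolouring. So a pass of joins and a pass of recolourings make one round, and after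
    [r] rounds the sets with at most [r] vertices are settled: hence [n] rounds. The polynomial is
    used only through a bound [c * n.+1 ^ k] for its values. The constants [c] and [k] are built
    into the program, which computes this number [N] and uses it as the limit of its loops over the
    list of connected sets. The program is written in a loop language in which the running time
    follows from a bound on the loop limits; since no limit is written once the loops that use it
    have started, such a bound is little more than a syntactic check. *)

Section Connectivity.
Variable G : sgraph.
Implicit Types (A B X Y Z : {set G}) (u v : G).

Definition separated A B : bool := [forall u in A, forall v in B, ~~ adj u v].

(** Absence of separations rather than existence of paths, because derivations will be cut along
    separations. The empty set counts as connected, whence the side conditions [A != set0] in what
    follows. *)
Definition conn A : bool :=
  [forall B : {set G}, (B \subset A) ==> separated B (A :\: B) ==>
     (B == set0) || (B == A)].

Lemma separatedP A B :
  reflect (forall u v, u \in A -> v \in B -> ~~ adj u v) (separated A B).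
Proof.
apply: (iffP forall_inP) => [H u v uA vB | H u uA].
  by move/forall_inP: (H u uA); apply.
by apply/forall_inP => v; apply: H.
Qed.

Lemma separatedPn A B :
  reflect (exists u v, [/\ u \in A, v \in B & adj u v]) (~~ separated A B).
Proof.
rewrite negb_forall_in; apply: (iffP exists_inP) => [[u uA] | [u [v [uA vB uv]]]].
  by rewrite negb_forall_in => /exists_inP[v vB /negPn uv]; exists u, v.
by exists u => //; rewrite negb_forall_in; apply/exists_inP; exists v => //; rewrite uv.
Qed.

Lemma separated_sym A B : separated A B = separated B A.
Proof.
by apply/separatedP/separatedP => H u v uA vB; rewrite adj_sym; apply: H.
Qed.

Lemma separatedS A A' B B' :
  A' \subset A -> B' \subset B -> separated A B -> separated A' B'.
Proof.
move=> /subsetP sA /subsetP sB /separatedP H.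
by apply/separatedP => u v /sA uA /sB vB; apply: H.
Qed.

Lemma connP A :
  reflect (forall B, B \subset A -> separated B (A :\: B) -> B = set0 \/ B = A)
          (conn A).
Proof.
apply: (iffP forallP) => [H B sBA sep | H B].
  by move: (H B); rewrite sBA sep => /orP[] /eqP; auto.
by apply/implyP=> sBA; apply/implyP=> /(H B sBA)[] ->; rewrite eqxx ?orbT.
Qed.

Lemma conn1 v : conn [set v].
Proof. by apply/connP => B; rewrite subset1 => /orP[] /eqP->; auto. Qed.

(* A separated part of a connected set lies on one side of any separation. *)
Lemma conn_sub A B X :
  conn X -> X \subset A -> B \subset A -> separated B (A :\: B) ->
  X \subset B \/ [disjoint X & B].
Proof.
move=> /connP cX sXA sBA sep.
have sep' : separated (X :&: B) (X :\: (X :&: B)).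
  by apply: separatedS sep; rewrite ?subsetIr // setDIr setDv set0U setSD.
case: (cX _ (subsetIl _ _) sep') => [XB | /setIidPl]; last by left.
by right; rewrite -setI_eq0 XB.
Qed.

Lemma connU A B : conn A -> conn B -> (A :&: B != set0) || ~~ separated A B ->
  conn (A :|: B).
Proof.
move=> cA cB AB; apply/connP => Z sZ sep.
have [sAZ | dAZ] := conn_sub cA (subsetUl A B) sZ sep;
have [sBZ | dBZ] := conn_sub cB (subsetUr A B) sZ sep.
- by right; apply/eqP; rewrite eqEsubset sZ subUset sAZ.
- case/orP: AB => [/set0Pn[x /setIP[xA xB]] | /separatedPn[u [v [uA vB uv]]]].
    by move: (subsetP sAZ x xA); rewrite (disjointFr dBZ xB).
  move/separatedP/(_ u v (subsetP sAZ u uA)): sep.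
  by rewrite !inE vB orbT (disjointFr dBZ vB) uv => /(_ isT).
- case/orP: AB => [/set0Pn[x /setIP[xA xB]] | /separatedPn[u [v [uA vB uv]]]].
    by move: (subsetP sBZ x xB); rewrite (disjointFr dAZ xA).
  rewrite separated_sym in sep.
  move/separatedP/(_ u v): sep.
  by rewrite !inE uA (disjointFr dAZ uA) uv (subsetP sBZ) // => /(_ isT isT).
left; apply/eqP; rewrite -subset0; apply/subsetP => x xZ.
have := subsetP sZ x xZ; rewrite inE => /orP[] xx.
  by rewrite (disjointFr dAZ xx) in xZ.
by rewrite (disjointFr dBZ xx) in xZ.
Qed.

Lemma conn_edge A B : conn A -> B \subset A -> B != set0 -> B != A ->
  exists u v, [/\ u \in B, v \in A :\: B & adj u v].
Proof.
move=> /connP cA sBA B0 BA; apply/separatedPn/negP => sep.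
by case: (cA B sBA sep) => E; rewrite E eqxx in B0 BA.
Qed.

(** A largest connected subset of [A] containing [v] serves: a neighbour left outside could be added
    to it. *)
Lemma conn_comp A v : v \in A ->
  exists Z, [/\ conn Z, v \in Z, Z \subset A & separated Z (A :\: Z)].
Proof.
move=> vA; pose P Z := [&& conn Z, v \in Z & Z \subset A].
have P1 : P [set v] by rewrite /P conn1 set11 sub1set.
case: (arg_maxnP (fun Z : {set G} => #|Z|) P1) => Z /and3P[cZ vZ sZ] maxZ.
exists Z; split=> //; apply/negPn/negP => /separatedPn[x [y [xZ /setDP[yA yZ] xy]]].
have : P (Z :|: [set y]).
  rewrite /P inE vZ subUset sZ sub1set yA !andbT.
  rewrite connU ?conn1 //; apply/orP; right.
  by apply/separatedPn; exists x, y; rewrite set11.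
by move/maxZ => /=; rewrite setUC cardsU1 yZ add1n ltnn.
Qed.

(** A largest proper connected subset misses a single vertex, since adding a neighbouring vertex
    must give all of [A]. This is why connected sets can be enumerated by adding one vertex at a
    time. *)
Lemma conn_noncut A : conn A -> 1 < #|A| -> exists2 v, v \in A & conn (A :\ v).
Proof.
move=> cA A1; have [v vA] : exists v, v \in A by apply/card_gt0P; apply: ltnW.
pose P (B : {set G}) := [&& conn B, B != set0 & B \proper A].
have P1 : P [set v].
  by rewrite /P conn1 -cards_eq0 cards1 properEcard sub1set vA cards1 A1.
case: (arg_maxnP (fun Z : {set G} => #|Z|) P1) => B /and3P[cB B0 pB] maxB.
have [sBA neq] : B \subset A /\ B != A by move: pB; rewrite properEneq => /andP[].
have [x [y [xB /setDP[yA yB] xy]]] := conn_edge cA sBA B0 neq.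
exists y => //; have cBy : conn (y |: B).
  rewrite setUC connU ?conn1 //; apply/orP; right.
  by apply/separatedPn; exists x, y; rewrite set11.
suff -> : A = y |: B by rewrite setU1K.
apply/eqP; rewrite eq_sym; apply: contraT => ne.
have : P (y |: B).
  by rewrite /P cBy properEneq ne subUset sub1set yA sBA -cards_eq0 cardsU1 yB.
by move/maxB => /=; rewrite cardsU1 yB add1n ltnn.
Qed.

(** The last two hypotheses say that [B] meets [X] and [Y] in unions of their components. The
    witness [Z] is the component of [v] in [X]: it misses [B], and adding it to [B] keeps this
    property. *)
Lemma conn_grow X Y B u v :
  [disjoint X & Y] -> conn B -> u \in B -> v \in X -> v \notin B -> adj u v ->
  separated (B :&: X) (X :\: B) -> separated (B :&: Y) (Y :\: B) ->
  exists Z, [/\ conn Z, Z != set0 & [disjoint Z & B]] /\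
    [/\ conn (B :|: Z), Z \subset X,
        separated ((B :|: Z) :&: X) (X :\: (B :|: Z)) &
        separated ((B :|: Z) :&: Y) (Y :\: (B :|: Z))].
Proof.
move=> dXY cB uB vX vB uv sepX sepY.
have [Z [cZ vZ sZ sepZ]] := conn_comp vX.
have dZB : [disjoint Z & B].
  have sep' : separated (B :&: X) (X :\: (B :&: X)) by rewrite setDIr setDv setU0.
  have [/subsetP/(_ v vZ) | dd] := conn_sub cZ sZ (subsetIr B X) sep'.
    by rewrite inE (negPf vB).
  by rewrite -setI_eq0 -(setIidPl sZ) -setIA [X :&: B]setIC setI_eq0.
exists Z; split; split=> //.
- by apply/set0Pn; exists v.
- by rewrite connU // orbC; apply/orP; left; apply/separatedPn; exists u, v.
- apply/separatedP => x y; rewrite !inE negb_or => /andP[xBZ xX] /andP[/andP[yB yZ] yX].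
  case/orP: xBZ => [xB|xZ].
    by apply: (separatedP _ _ sepX); rewrite !inE ?xB ?xX ?yB ?yX.
  by apply: (separatedP _ _ sepZ); rewrite // !inE yZ yX.
have ZY x : x \in Z -> x \in Y = false.
  by move=> xZ; apply: (disjointFr dXY); apply: (subsetP sZ).
apply/separatedP => x y; rewrite !inE negb_or => /andP[xBZ xY] /andP[/andP[yB yZ] yY].
apply: (separatedP _ _ sepY); rewrite !inE ?xY ?yB ?yY // andbT.
by case/orP: xBZ => // /ZY; rewrite xY.
Qed.

(** The components of [X] and of [Y] are the nodes of a connected quotient graph, and a node that
    does not disconnect it is removed. When [B] is largest, one more component completes it to
    [X :|: Y]; the complement of [B] is that component, hence connected. *)
Lemma conn_bipartition X Y : conn (X :|: Y) -> [disjoint X & Y] -> X != set0 -> Y != set0 ->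
  exists B, [/\ B \proper X :|: Y, B != set0, conn B & conn ((X :|: Y) :\: B)] /\
    separated (B :&: X) (X :\: B) /\ separated (B :&: Y) (Y :\: B).
Proof.
move=> cXY dXY /set0Pn[x xX] /set0Pn[y yY].
pose P B := [&& conn B, B != set0, B \proper X :|: Y,
  separated (B :&: X) (X :\: B) & separated (B :&: Y) (Y :\: B)].
have [B0 [cB0 xB0 sB0 sepB0]] := conn_comp xX.
have P0 : P B0.
  have dB0Y : [disjoint B0 & Y] by apply: disjointWl dXY.
  rewrite /P cB0 (setIidPl sB0) sepB0; apply/and4P; split=> //.
  - by apply/set0Pn; exists x.
  - apply/properP; split; first by apply: subset_trans sB0 (subsetUl _ _).
    by exists y; rewrite ?inE ?yY ?orbT // (disjointFl dB0Y).
  - by rewrite (disjoint_setI0 dB0Y); apply/separatedP => u v; rewrite inE.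
case: (arg_maxnP (fun Z : {set G} => #|Z|) P0) => B /and5P[cB n0B pB sepX sepY] maxB.
exists B; split=> //; split=> //.
have [sB neB] : B \subset X :|: Y /\ B != X :|: Y.
  by move: pB; rewrite properEneq => /andP[].
have [u [v [uB /setDP[vXY vB] uv]]] := conn_edge cXY sB n0B neB.
have [Z [[cZ n0Z dZB] [cBZ sZ sepX' sepY']]] :
  exists Z, [/\ conn Z, Z != set0 & [disjoint Z & B]] /\
    [/\ conn (B :|: Z), Z \subset X :|: Y,
        separated ((B :|: Z) :&: X) (X :\: (B :|: Z)) &
        separated ((B :|: Z) :&: Y) (Y :\: (B :|: Z))].
  move: vXY; rewrite inE => /orP[vX | vY].
    have [Z [H [H1 H2 H3 H4]]] := conn_grow dXY cB uB vX vB uv sepX sepY.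
    by exists Z; split=> //; split=> //; apply: subset_trans H2 (subsetUl _ _).
  rewrite disjoint_sym in dXY.
  have [Z [H [H1 H2 H3 H4]]] := conn_grow dXY cB uB vY vB uv sepY sepX.
  by exists Z; split=> //; split=> //; apply: subset_trans H2 (subsetUr _ _).
suff -> : X :|: Y = B :|: Z.
  by rewrite setDUl setDv set0U (_ : Z :\: B = Z) //; apply/setDidPl.
apply/eqP; rewrite eq_sym; apply: contraT => ne.
have : P (B :|: Z).
  rewrite /P cBZ properEneq ne subUset sB sZ sepX' sepY' !andbT /=.
  by apply: contra n0B; rewrite setU_eq0 => /andP[].
move/maxB => /=; rewrite cardsU [B :&: Z]setIC (disjoint_setI0 dZB) cards0 subn0 => le.
by move: le; rewrite -[X in _ <= X]addn0 leq_add2l leqNgt card_gt0 n0Z.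
Qed.

(** * Connected sets and connected subgraphs *)

Definition induced A : {set G} * {set {set G}} :=
  (A, [set f in edges G | f \subset A]).

Lemma induced_connected A :
  conn A -> A != set0 -> induced A \in connected_subgraphs G.
Proof.
move=> cA A0; rewrite inE /is_subgraph /is_connected /= A0 /=.
apply/andP; split.
  apply/andP; split; first by apply/subsetP => f; rewrite inE => /andP[].
  by apply/forall_inP => f; rewrite inE => /andP[].
apply/forall_inP => u uA; apply/forall_inP => v vA.
set e := [rel x y | _].
have sR : [set x in A | connect e u x] \subset A.
  by apply/subsetP=> x; rewrite inE => /andP[].
have sep : separated [set x in A | connect e u x] (A :\: [set x in A | connect e u x]).
  apply/separatedP => x y; rewrite !inE => /andP[xA ux].
  rewrite negb_and => /andP[/orP[/negP// | nuy] yA]; apply: contra nuy => xy.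
  apply: connect_trans ux (connect1 _); rewrite /= !inE subUset !sub1set xA yA !andbT.
  by apply/existsP; exists x; apply/existsP; exists y; rewrite xy /=.
have [R0|RA] := connP _ cA _ sR sep.
  by have := in_set0 u; rewrite -R0 inE uA connect0.
by move: vA; rewrite -{1}RA inE => /andP[].
Qed.

(** A vertex set is recovered from the subgraph it induces, so a bound on all connected subgraphs
    bounds the number of connected sets. *)
Lemma card_conn : #|[set A : {set G} | conn A && (A != set0)]| <= #|connected_subgraphs G|.
Proof.
rewrite -(card_in_imset (f := induced)); last by move=> A B _ _ [].
apply/subset_leq_card/subsetP => _ /imsetP[A + ->].
by rewrite inE => /andP[]; apply: induced_connected.
Qed.

End Connectivity.

(** * Floods, paintings and derivations *)

Section Painting.
Variables (G : sgraph) (C : finType).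
Implicit Types (w f : {ffun G -> C}) (A B X Y Z : {set G}) (u v : G) (c d e : C) (k : nat).

Lemma mem_mono_component w v : v \in mono_component w v.
Proof. by rewrite inE connect0. Qed.

Lemma mono_sym w : connect_sym [rel x y : G | adj x y && (w x == w y)].
Proof.
by apply: sym_connect_sym => x y /=; rewrite adj_sym eq_sym.
Qed.

Lemma mono_component_colour w v u : u \in mono_component w v -> w u = w v.
Proof.
rewrite inE => vu; have cl : closed [rel x y : G | adj x y && (w x == w y)] [pred x | w x == w v].
  by move=> x y /= /andP[_ /eqP]; rewrite !inE => ->.
by have := closed_connect cl vu; rewrite !inE eqxx => /esym/eqP.
Qed.

Lemma mono_component_conn w v : conn (mono_component w v).
Proof.
set K := mono_component w v; apply/connP => B sBK sep.
have cl : closed [rel x y : G | adj x y && (w x == w y)] [in B].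
  apply: intro_closed; first exact: mono_sym.
  move=> x y /= xy xB; apply/negPn/negP => yB.
  have yK : y \in K.
    have := subsetP sBK x xB; rewrite !inE => vx.
    by apply: connect_trans vx _; apply: connect1.
  have /separatedP/(_ x y xB) := sep; rewrite inE yB yK => /(_ isT).
  by case/andP: xy => ->.
have vB x : x \in K -> (v \in B) = (x \in B) by rewrite inE => /(closed_connect cl).
have [vinB | vninB] := boolP (v \in B); [right|left].
  by apply/eqP; rewrite eqEsubset sBK; apply/subsetP => x /vB <-.
apply/eqP; rewrite -subset0; apply/subsetP => x xB.
by have := subsetP sBK x xB => /vB; rewrite xB (negPf vninB).
Qed.

Lemma mono_component_max w v X : conn X -> v \in X ->
  (forall u, u \in X -> w u = w v) -> X \subset mono_component w v.
Proof.
move=> cX vX mX; set K := mono_component w v.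
have sep : separated (X :&: K) (X :\: (X :&: K)).
  apply/separatedP => x y; rewrite !inE => /andP[xX vx] /andP[+ yX]; rewrite yX /=.
  apply: contra => xy; apply: connect_trans vx (connect1 _).
  by rewrite /= xy (mX x xX) (mX y yX) eqxx.
have [XK|/setIidPl//] := connP _ cX _ (subsetIl _ _) sep.
by have := in_set0 v; rewrite -XK inE vX mem_mono_component.
Qed.

Lemma mono_component_separated w v :
  separated (mono_component w v) ([set u | w u == w v] :\: mono_component w v).
Proof.
apply/separatedP => x y xK; rewrite inE => /andP[yK]; rewrite inE => wy.
have wx := mono_component_colour xK; apply: contra yK => xy; move: xK.
rewrite !inE => xK; apply: connect_trans xK (connect1 _).
by rewrite /= xy (eqP wy) wx eqxx.
Qed.

Lemma floodable_inP w d k :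
  reflect (exists2 s, size s = k & play w s = [ffun => d]) (floodable_in w d k).
Proof.
apply: (iffP existsP) => [[s /eqP sd] | [s sk sd]].
  by exists s; rewrite ?size_tuple.
by move/eqP: sk => sk; exists (Tuple sk); apply/eqP.
Qed.

Definition paint f (m : {set G} * C) : {ffun G -> C} :=
  [ffun u => if u \in m.1 then m.2 else f u].

Lemma paint_outside f u (l : seq ({set G} * C)) :
  all (fun m : {set G} * C => u \notin m.1) l -> foldl paint f l u = f u.
Proof.
elim: l f => //= m l IHl f /andP[um /IHl->].
by rewrite ffunE (negPf um).
Qed.

(* Painting is flooding read backwards.  The last stroke [X] shows a single
   colour in the final picture, so one flood can recolour the component [K]
   of [X]; enlarging the other strokes that meet [K] so that they cover [K]
   paints [K] in one colour and leaves the rest of the picture unchanged. *)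
Lemma flood_of_paint w d (l : seq ({set G} * C)) :
  all (fun m : {set G} * C => conn m.1 && (m.1 != set0)) l -> foldl paint [ffun => d] l = w ->
  floodable_in w d (size l).
Proof.
elim: {l}(size l) {-2}l (erefl (size l)) w => [|k IHk] l szl w.
  by case: l szl => // _ _ /= <-; apply/floodable_inP; exists [::].
case/lastP: l szl => // l [X c]; rewrite size_rcons => -[szl].
rewrite all_rcons foldl_rcons => /andP[/andP[/= cX /set0Pn[v vX]] al] wE.
pose f0 : {ffun G -> C} := [ffun => d].
set K := mono_component w v.
have wX u : u \in X -> w u = c by move=> uX; rewrite -wE ffunE uX.
have sXK : X \subset K.
  by apply: mono_component_max => // u uX; rewrite !wX.
pose ext (m : {set G} * C) := (if m.1 :&: K == set0 then m.1 else m.1 :|: K, m.2).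
pose f1 := foldl paint f0 (map ext l).
have vK : v \in K := mem_mono_component w v.
have outK u f f' l' : u \notin K -> f u = f' u ->
    foldl paint f (map ext l') u = foldl paint f' l' u.
  move=> uK; elim: l' f f' => //= m l' IHl' f f' ff'; apply: IHl'.
  by rewrite !ffunE /=; case: (_ == set0); rewrite ?in_setU ?(negPf uK) ?orbF ff'.
have inK u f l' : u \in K -> f u = f v ->
    foldl paint f (map ext l') u = foldl paint f (map ext l') v.
  move=> uK; elim: l' f => //= m l' IHl' f ff; apply: IHl'.
  rewrite !ffunE /=; case: eqP => [mK | _]; last by rewrite !in_setU uK vK !orbT.
  have out x : x \in K -> x \in m.1 = false.
    by move=> xK; apply/negP => xm; have := in_set0 x; rewrite -mK in_setI xm xK.
  by rewrite !out.
have f1E : f1 = flood w (v, f1 v).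
  apply/ffunP => u; rewrite [RHS]ffunE /= -/K; case: ifP => uK.
    by apply: inK => //; rewrite !ffunE.
  rewrite -wE [RHS]ffunE (negPf (contra (subsetP sXK u) (negbT uK))) /=.
  by apply: outK; rewrite ?uK.
have all1 : all (fun m : {set G} * C => conn m.1 && (m.1 != set0)) (map ext l).
  rewrite all_map; apply: sub_all al => m /andP[cm m0] /=.
  case: ifP => mK; rewrite ?cm ?m0 //= connU ?mono_component_conn ?mK //=.
  by apply/set0Pn; exists v; rewrite inE vK orbT.
have /floodable_inP[s] := IHk (map ext l) (etrans (size_map _ _) szl) _ all1 f1E.
by rewrite size_map => szs sE; apply/floodable_inP; exists ((v, f1 v) :: s); rewrite /= ?szs.
Qed.

(* [A] may be disconnected in [der w A d k]; only [DerM] needs connectedness. *)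
Inductive der w : {set G} -> C -> nat -> Prop :=
  | Der0 d : der w set0 d 0
  | Der1 v : der w [set v] (w v) 0
  | DerU A B d i j : [disjoint A & B] -> der w A d i -> der w B d j ->
      der w (A :|: B) d (i + j)
  | DerM A d e i : conn A -> A != set0 -> der w A d i -> der w A e i.+1.

(** For a union the two paintings are played one after the other; they do not interfere, since the
    strokes of each stay inside its set. A recolouring becomes a first stroke covering all of [A],
    which hides the colour of the canvas. *)
Lemma paint_of_der w A d k : der w A d k ->
  exists l : seq ({set G} * C), [/\ size l = k,
    all (fun m : {set G} * C => conn m.1 && (m.1 != set0)) l,
    all (fun m : {set G} * C => m.1 \subset A) l &
    forall f, (forall u, u \in A -> f u = d) ->
      forall u, u \in A -> foldl paint f l u = w u].
Proof.
elim=> {A d k} [d | v | A B d i j dAB _ [l1 [sz1 c1 s1 p1]] _ [l2 [sz2 c2 s2 p2]]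
               | A d e i cA A0 _ [l [sz c s p]]].
- by exists [::]; split=> // f _ u; rewrite inE.
- by exists [::]; split=> // f fv u uv; rewrite /= fv // (set1P uv).
- exists (l1 ++ l2); split.
  + by rewrite size_cat sz1 sz2.
  + by rewrite all_cat c1.
  + rewrite all_cat; apply/andP; split.
      by apply: sub_all s1 => m /subset_trans; apply; apply: subsetUl.
    by apply: sub_all s2 => m /subset_trans; apply; apply: subsetUr.
  move=> f fd u; rewrite foldl_cat; have [uB _ | uB] := boolP (u \in B).
    apply: p2 => // x xB; rewrite paint_outside ?fd ?inE ?xB ?orbT //.
    apply: sub_all s1 => m /subsetP sm; apply/negP => /sm.
    by rewrite (disjointFl dAB xB).
  rewrite inE (negPf uB) orbF => uA; rewrite paint_outside ?p1 //.
    by move=> x xA; rewrite fd // inE xA.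
  by apply: sub_all s2 => m /subsetP sm; apply: contra uB => /sm.
exists ((A, d) :: l); split => /=; rewrite ?sz ?c ?s ?cA ?A0 ?subxx //.
by move=> f _ u uA; apply: p => // x xA; rewrite ffunE xA.
Qed.

Lemma min_moves_to_le w d k : der w setT d k -> min_moves_to w d <= k.
Proof.
case/paint_of_der => l [<- cl _ p]; rewrite /min_moves_to; case: ex_minnP => n _; apply.
apply: flood_of_paint => //; apply/ffunP => u; apply: p => // x _; exact: ffunE.
Qed.

(* Both parts inherit the derivation because every connected set occurring in
   it lies on one side of the separation. *)
Lemma der_split w A d k X : der w A d k -> X \subset A -> separated X (A :\: X) ->
  exists i j, [/\ der w X d i, der w (A :\: X) d j & i + j <= k].
Proof.
move=> D; elim: D X => {A d k} [d | v | A B d i j dAB DA IHA DB IHB | A d e i cA A0 D IH] X.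
- rewrite subset0 => /eqP-> _; exists 0, 0; rewrite setDv; split=> //; exact: Der0.
- rewrite subset1 => /orP[] /eqP-> _; exists 0, 0; rewrite ?setD0 ?setDv;
    split => //; by [exact: Der0 | exact: Der1].
- move=> sX sep.
  have [||i1 [j1 [DA1 DA2 le1]]] := IHA (X :&: A); first exact: subsetIr.
    by apply: separatedS sep; rewrite ?subsetIl // setDIr setDv setU0 setSD ?subsetUl.
  have [||i2 [j2 [DB1 DB2 le2]]] := IHB (X :&: B); first exact: subsetIr.
    by apply: separatedS sep; rewrite ?subsetIl // setDIr setDv setU0 setSD ?subsetUr.
  exists (i1 + i2), (j1 + j2); split; last by rewrite addnACA leq_add.
    rewrite -(setIidPl sX) setIUr; apply: DerU => //.
    by apply: disjointW dAB; rewrite subsetIr.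
  rewrite setDUl -[A :\: X]set0U -[B :\: X]set0U.
  rewrite -{1}(setDv A) -(setDv B) -!setDIr [A :&: X]setIC [B :&: X]setIC.
  by apply: DerU => //; apply: disjointW dAB; apply: subsetDl.
move=> sX sep; have [->|->] := connP _ cA _ sX sep.
  by exists 0, i.+1; rewrite setD0; split=> //; [exact: Der0 | exact: DerM D].
by exists i.+1, 0; rewrite setDv addn0; split=> //; [exact: DerM D | exact: Der0].
Qed.

Lemma der_colour_class w c A : (forall u, u \in A -> w u = c) -> der w A c 0.
Proof.
elim: {A}#|A| {-2}A (erefl #|A|) => [|k IHk] A Ak wA.
  by move/eqP: Ak; rewrite cards_eq0 => /eqP->; exact: Der0.
have [v vA] : exists v, v \in A by apply/card_gt0P; rewrite Ak.
rewrite -(setD1K vA) -(addn0 0); apply: DerU.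
- by rewrite -setI_eq0; apply/eqP/setP => u; rewrite !inE; case: eqP => // ->; rewrite ?andbF.
- by rewrite -(wA v vA); exact: Der1.
- by apply: IHk => [|u /setD1P[_ /wA]//]; move: Ak; rewrite (cardsD1 v) vA => -[].
Qed.

(* Every flood recolours a component, so it costs one [DerM] step for that
   component and a union with the class of its new colour. *)
Lemma der_play w (s : seq (G * C)) : exists n : C -> nat,
  (forall c, der w [set u | play w s u == c] c (n c)) /\ \sum_c n c <= size s.
Proof.
elim/last_ind: s => [|s [v e] [n [D le]]].
  exists (fun=> 0); split; last by rewrite sum_nat_const muln0.
  by move=> c; apply: der_colour_class => u; rewrite inE => /eqP.
rewrite /play foldl_rcons -/(play w s) size_rcons; set f := play w s in D *.
set K := mono_component f v; have KE u : u \in K -> f u = f v by apply: mono_component_colour.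
have clsE (g : {ffun G -> C}) c u : (u \in [set u | g u == c]) = (g u == c) by rewrite in_set.
have [fe | fe] := eqVneq (f v) e.
  exists n; split; last exact: leqW.
  move=> c; suff -> : flood f (v, e) = f by [].
  by apply/ffunP => u; rewrite ffunE /= -/K; case: ifP => // /KE ->.
have sK : K \subset [set u | f u == f v].
  by apply/subsetP => u /KE uK; rewrite inE uK.
have [i [j [DK DR ij]]] := der_split (D (f v)) sK (mono_component_separated f v).
(* The rest of the old class keeps cost [j]; the class of [e] gains the component [K] for [i] plus
   one recolouring. As [i + j] is at most the old cost of the class of [f v], the total grows by at
   most 1. *)
exists (fun c => if c == f v then j else if c == e then n e + i.+1 else n c); split.
  move=> c; case: (eqVneq c (f v)) => [-> | cv].
    suff <- : [set u | f u == f v] :\: K = [set u | flood f (v, e) u == f v] by [].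
    apply/setP => u; rewrite in_setD !clsE ffunE /= -/K; case: ifP => //= _.
    by rewrite eq_sym (negPf fe).
  case: (eqVneq c e) => [-> | ce].
    suff <- : [set u | f u == e] :|: K = [set u | flood f (v, e) u == e].
      apply: DerU => //; last first.
        by apply: DerM DK; [exact: mono_component_conn | apply/set0Pn; exists v;
          exact: mem_mono_component].
      rewrite disjoint_sym disjoints_subset; apply/subsetP => u /KE uK.
      by rewrite !inE uK.
    apply/setP => u; rewrite in_setU !clsE ffunE /= -/K; case: ifP => //= _.
      by rewrite ?orbT ?eqxx.
    by rewrite orbF.
  suff <- : [set u | f u == c] = [set u | flood f (v, e) u == c] by [].
  apply/setP => u; rewrite !clsE ffunE /= -/K; case: ifP => //= /KE ->.
  by rewrite eq_sym (negPf cv) eq_sym (negPf ce).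
rewrite (bigD1 (f v)) //= (bigD1 e) 1?eq_sym //=.
rewrite (bigD1 (f v)) //= (bigD1 e) 1?eq_sym //= in le.
rewrite eqxx [e == f v]eq_sym (negPf fe) eqxx.
rewrite (eq_bigr n); last by move=> c /andP[/negPf-> /negPf->].
by move: le ij; set S := \sum_(_ | _) _; lia.
Qed.

(** After an optimal game the class of [d] is the whole vertex set, and its share of the total cost
    is at most the number of moves; by [min_moves_to_le] it cannot be less. *)
Lemma min_moves_to_der w d : der w setT d (min_moves_to w d).
Proof.
rewrite /min_moves_to; case: ex_minnP => k /floodable_inP[s szs sE] min.
have [n [D le]] := der_play w s.
have nd : der w setT d (n d).
  by move: (D d); rewrite sE; congr (der w _ d _); apply/setP => u; rewrite !inE ffunE eqxx.
have le1 : n d <= k by rewrite -szs; apply: leq_trans le; rewrite (bigD1 d) //= leq_addr.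
suff -> : k = n d by [].
apply/eqP; rewrite eqn_leq le1 andbT.
have := min_moves_to_le nd; rewrite /min_moves_to.
by case: ex_minnP => m /min km _; apply: leq_trans.
Qed.

(** The recurrence behind the table. All recolourings at the top of a derivation can be replaced by
    a single one, which a strict inequality pays for. A union of possibly disconnected parts is
    regrouped by [conn_bipartition] into two connected ones, at no extra cost by [der_split]. *)
Lemma der_conn_split w A d k : der w A d k -> conn A -> 1 < #|A| ->
  exists B B' e i j, [/\ B :|: B' = A, [disjoint B & B'],
    [/\ conn B, conn B', B != set0 & B' != set0],
    der w B e i /\ der w B' e j & (i + j <= k) && (e == d) || (i + j < k)].
Proof.
elim=> {A d k} [d | v | X Y d i j dXY DX IHX DY IHY | A d e i _ A0 D IH] cA A1.
- by rewrite cards0 in A1.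
- by rewrite cards1 in A1.
- have [X0 | [x0 x0X]] := set_0Vmem X.
    move: cA A1; rewrite X0 set0U => cA A1.
    have [B [B' [e [i' [j' [H1 H2 H3 H4 H5]]]]]] := IHY cA A1.
    exists B, B', e, i', j'; split=> //; case/orP: H5 => [/andP[le ->]|lt]; apply/orP;
      [left|right]; lia.
  have [Y0 | [y0 y0Y]] := set_0Vmem Y.
    move: cA A1; rewrite Y0 setU0 => cA A1.
    have [B [B' [e [i' [j' [H1 H2 H3 H4 H5]]]]]] := IHX cA A1.
    exists B, B', e, i', j'; split=> //; case/orP: H5 => [/andP[le ->]|lt]; apply/orP;
      [left|right]; lia.
  have X0 : X != set0 by apply/set0Pn; exists x0.
  have Y0 : Y != set0 by apply/set0Pn; exists y0.
  have [B [[pB B0 cB cB'] [sepX sepY]]] := conn_bipartition cA dXY X0 Y0.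
  have sepI (Z : {set G}) : separated (B :&: Z) (Z :\: B) -> separated (B :&: Z) (Z :\: (B :&:
    Z)).
    by rewrite setDIr setDv setU0.
  have [i1 [i2 [D1 D2 le1]]] := der_split DX (subsetIr B X) (sepI _ sepX).
  have [j1 [j2 [E1 E2 le2]]] := der_split DY (subsetIr B Y) (sepI _ sepY).
  exists B, ((X :|: Y) :\: B), d, (i1 + j1), (i2 + j2); split.
  - by rewrite -{1}(setIidPr (proper_sub pB)) setID.
  - by rewrite disjoint_sym disjoints_subset subsetDr.
  - split=> //; rewrite setD_eq0; by case/andP: pB.
  - split.
      rewrite -(setIidPl (proper_sub pB)) setIUr; apply: DerU => //.
      by apply: disjointW dXY; rewrite subsetIr.
    rewrite setDUl; apply: DerU.
    + by apply: disjointW dXY; rewrite subsetDl.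
    + by move: D2; rewrite setDIr setDv setU0.
    + by move: E2; rewrite setDIr setDv setU0.
  by apply/orP; left; rewrite eqxx andbT addnACA leq_add.
have [B [B' [e' [i' [j' [H1 H2 H3 H4 H5]]]]]] := IH cA A1.
exists B, B', e', i', j'; split=> //; apply/orP; right.
by case/orP: H5 => [/andP[le _]|]; lia.
Qed.

Lemma der1_inv w v d k : der w [set v] d k -> (w v == d) || (0 < k).
Proof.
move E : [set v] => A D; elim: D E => {A d k} [d | u | A B d i j _ _ IHA _ IHB | *];
  last by rewrite orbT.
- by move/setP/(_ v); rewrite !inE eqxx.
- by move/set1_inj->; rewrite eqxx.
move=> AB; have : v \in A :|: B by rewrite -AB set11.
have sub : A \subset [set v] /\ B \subset [set v] by rewrite AB subsetUl subsetUr.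
case: sub => sA sB /setUP[vA|vB].
  have EA : [set v] = A by apply/eqP; rewrite eqEsubset sub1set vA sA.
  by case/orP: (IHA EA) => [->//|i0]; rewrite ltn_addr ?orbT.
have EB : [set v] = B by apply/eqP; rewrite eqEsubset sub1set vB sB.
by case/orP: (IHB EB) => [->//|j0]; rewrite ltn_addl ?orbT.
Qed.

Lemma disjoint_bigcup_seq A (As : seq {set G}) :
  all (fun B : {set G} => [disjoint A & B]) As -> [disjoint A & \bigcup_(B <- As) B].
Proof.
move/allP=> dA; rewrite big_seq; apply: (big_ind (fun B : {set G} => [disjoint A & B])) => //.
  by rewrite -setI_eq0 setI0.
by move=> X Y; rewrite -!setI_eq0 setIUr setU_eq0 => -> ->.
Qed.

Lemma der_bigcup w (As : seq {set G}) d (m : {set G} -> nat) :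
  pairwise (fun A B : {set G} => [disjoint A & B]) As ->
  (forall A, A \in As -> der w A d (m A)) ->
  der w (\bigcup_(A <- As) A) d (\sum_(A <- As) m A).
Proof.
elim: As => [|A As IHAs]; first by rewrite !big_nil => _ _; exact: Der0.
rewrite !big_cons /= => /andP[dA pA] D; apply: DerU.
- exact: disjoint_bigcup_seq.
- by apply: D; rewrite mem_head.
by apply: IHAs => // B BAs; apply: D; rewrite inE BAs orbT.
Qed.

(** Each set of [As] is separated from everything else, so [der_split] peels them off one at a time.
    This gives the lower bound for a sum over components, and [der_bigcup] the upper bound. *)
Lemma der_bigcup_le w (As : seq {set G}) d k (m : {set G} -> nat) A0 :
  pairwise (fun A B : {set G} => [disjoint A & B]) As ->
  (forall A, A \in As -> separated A (~: A)) ->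
  (forall A j, A \in As -> der w A d j -> m A <= j) ->
  A0 = \bigcup_(A <- As) A -> der w A0 d k -> \sum_(A <- As) m A <= k.
Proof.
elim: As A0 k => [|A As IHAs] A0 k; first by rewrite !big_nil.
rewrite !big_cons /= => /andP[dA pA] sep min -> D.
have dAU : [disjoint A & \bigcup_(B <- As) B].
  exact: disjoint_bigcup_seq.
have [||i [j [D1 D2 le]]] := der_split (X := A) D; first exact: subsetUl.
  by apply: separatedS (sep A (mem_head _ _)); rewrite // setDE subsetIr.
have := min A i (mem_head _ _) D1 => le1.
have le2 : \sum_(B <- As) m B <= j.
  apply: IHAs (erefl _) _ => //.
  - by move=> B BAs; apply: sep; rewrite inE BAs orbT.
  - by move=> B j' BAs; apply: min; rewrite inE BAs orbT.
  move: D2; rewrite setDUl setDv set0U (_ : _ :\: A = \bigcup_(B <- As) B) //.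
  by apply/setDidPl; rewrite disjoint_sym.
lia.
Qed.
End Painting.

(** * A loop language compiled to random access machines *)

(* The memory of the machine is shared by 32 infinite arrays; scalars are
   entries of index 0, and the last array holds the temporaries. *)
Definition loc (a i : nat) : nat := a + 32 * i.
Notation tmp := (loc 31).

Inductive expr : Type :=
  | ENum of nat
  | EAdd of expr & expr
  | ESub of expr & expr
  | EGet of nat & expr.

Inductive cmd : Type :=
  | Put of nat & expr & expr
  | Read of nat
  | Seq of cmd & cmd
  | When of expr & cmd
  | For of nat & nat & cmd.

Record state := State { arr : nat -> nat -> nat; inp : seq nat }.

Definition upd2 (M : nat -> nat -> nat) (a i v : nat) : nat -> nat -> nat :=
  fun b j => if (b == a) && (j == i) then v else M b j.

Definition put (S : state) (a i v : nat) : state := State (upd2 (arr S) a i v) (inp S).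

Fixpoint loop (f : nat -> state -> state) (n : nat) (S : state) : state :=
  if n is n'.+1 then f n' (loop f n' S) else S.

Fixpoint ev (e : expr) (S : state) : nat :=
  match e with
  | ENum n => n
  | EAdd e1 e2 => ev e1 S + ev e2 S
  | ESub e1 e2 => ev e1 S - ev e2 S
  | EGet a e1 => arr S a (ev e1 S)
  end.

Fixpoint den (c : cmd) (S : state) : state :=
  match c with
  | Put a e1 e2 => put S a (ev e1 S) (ev e2 S)
  | Read x => State (upd2 (arr S) x 0 (head 0 (inp S))) (behead (inp S))
  | Seq c1 c2 => den c2 (den c1 S)
  | When e c1 => if 0 < ev e S then den c1 S else S
  | For x y c1 => loop (fun i S' => den c1 (put S' x 0 i)) (arr S y 0) S
  end.

Fixpoint wfe (e : expr) : bool :=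
  match e with
  | ENum n => true
  | EAdd e1 e2 | ESub e1 e2 => wfe e1 && wfe e2
  | EGet a e1 => (a < 31) && wfe e1
  end.

Fixpoint wf (c : cmd) : bool :=
  match c with
  | Put a e1 e2 => [&& a < 31, wfe e1 & wfe e2]
  | Read x => x < 31
  | Seq c1 c2 => wf c1 && wf c2
  | When e c1 => wfe e && wf c1
  | For x y c1 => [&& x < 31, y < 31 & wf c1]
  end.

(** In the absence of multiplication, the index is multiplied by 32 through five doublings; then the
    number of the array is added. *)
Definition address (k a : nat) : program :=
  nseq 5 (IAdd (tmp k) (tmp k) (tmp k))
    ++ [:: IConst (tmp k.+1) a; IAdd (tmp k) (tmp k) (tmp k.+1)].

(* The value is left in [tmp k]; only temporaries from [k] on are used. *)
Fixpoint cexpr (k : nat) (e : expr) : program :=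
  match e with
  | ENum n => [:: IConst (tmp k) n]
  | EAdd e1 e2 => cexpr k e1 ++ cexpr k.+1 e2 ++ [:: IAdd (tmp k) (tmp k) (tmp k.+1)]
  | ESub e1 e2 => cexpr k e1 ++ cexpr k.+1 e2 ++ [:: ISub (tmp k) (tmp k) (tmp k.+1)]
  | EGet a e1 => cexpr k e1 ++ address k a ++ [:: ILoad (tmp k) (tmp k)]
  end.

(* In a loop, [tmp k] counts the remaining rounds and [tmp k.+1] the rounds done. *)
Fixpoint ccmd (p k : nat) (c : cmd) : program :=
  match c with
  | Put a e1 e2 =>
      cexpr k e1 ++ address k a ++ cexpr k.+1 e2 ++ [:: IStore (tmp k) (tmp k.+1)]
  | Read x => [:: IRead x]
  | Seq c1 c2 => let s := ccmd p k c1 in s ++ ccmd (p + size s) k c2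
  | When e c1 =>
      let s := cexpr k e ++ [:: IConst (tmp k.+1) 1; ISub (tmp k) (tmp k.+1) (tmp k)] in
      let body := ccmd (p + size s).+1 k c1 in
      s ++ IJpos (tmp k) ((p + size s).+1 + size body) :: body
  | For x y c1 =>
      let body := ccmd (p + 6) k.+2 c1 in
      [:: IConst (tmp k.+1) 0; IAdd (tmp k) y (tmp k.+1); IConst (tmp k.+2) 1;
          IJpos (tmp k.+2) (p + 6 + size body + 3);
          IConst (tmp k.+2) 0; IAdd x (tmp k.+1) (tmp k.+2)]
        ++ body
        ++ [:: IConst (tmp k.+2) 1; IAdd (tmp k.+1) (tmp k.+1) (tmp k.+2);
               ISub (tmp k) (tmp k) (tmp k.+2); IJpos (tmp k) (p + 4)]
  end.

(** * Runs of compiled code *)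

Definition straight (i : instr) : bool :=
  match i with IJpos _ _ | IRead _ => false | _ => true end.

Definition mexec (M : nat -> nat) (i : instr) : nat -> nat :=
  Defs.mem (exec i (Config 0 M [::])).

Lemma iter_straight code pre post M s : all straight code ->
  iter (size code) (step (pre ++ code ++ post)) (Config (size pre) M s) =
    Config (size pre + size code) (foldl mexec M code) s.
Proof.
elim: code pre M => [|i code IH] pre M; first by rewrite /= addn0.
move=> /andP[si sc]; rewrite [size _]/= iterSr.
have -> : step (pre ++ (i :: code) ++ post) (Config (size pre) M s) =
    Config (size (rcons pre i)) (mexec M i) s.
  rewrite /step /halted size_cat /= -[X in _ <= X]addn0 leq_add2l /=.
  rewrite nth_cat ltnn subnn /= size_rcons.
  by case: i si.
by rewrite -cat_rcons IH // size_rcons addnS addSn.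
Qed.

Lemma step_jump pre post x l M s :
  step (pre ++ IJpos x l :: post) (Config (size pre) M s) =
    Config (if 0 < M x then l else (size pre).+1) M s.
Proof.
rewrite /step /halted size_cat /= -[X in _ <= X]addn0 leq_add2l /=.
by rewrite nth_cat ltnn subnn.
Qed.

Definition keeps (k : nat) (M M' : nat -> nat) : Prop :=
  forall x, (forall j, k <= j -> x != tmp j) -> M' x = M x.

Definition represents (M : nat -> nat) (S : state) : Prop :=
  forall a i, a < 31 -> M (loc a i) = arr S a i.

Lemma keeps_trans k M1 M2 M3 : keeps k M1 M2 -> keeps k M2 M3 -> keeps k M1 M3.
Proof. by move=> K1 K2 x xk; rewrite K2 ?K1. Qed.

Lemma keepsS k M M' : keeps k.+1 M M' -> keeps k M M'.
Proof. by move=> K x xk; apply: K => j kj; apply: xk; apply: ltnW. Qed.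

Lemma keeps_upd k j M v : k <= j -> keeps k M (upd M (tmp j) v).
Proof. by move=> kj x /(_ j kj); rewrite /upd => /negPf->. Qed.

Lemma keeps_tmp k j M M' : keeps k M M' -> j < k -> M' (tmp j) = M (tmp j).
Proof. by move=> K jk; apply: K => i ki; rewrite /loc; apply/eqP; lia. Qed.

Lemma keeps_represents k M M' S : keeps k M M' -> represents M S -> represents M' S.
Proof.
by move=> K R a i a31; rewrite K ?R // => j _; rewrite /loc; apply/eqP; lia.
Qed.

Lemma tmp_neq j k : (tmp j == tmp k) = (j == k).
Proof. by rewrite /loc; apply/eqP/eqP; lia. Qed.

Lemma address_ok k a M : let M' := foldl mexec M (address k a) in
  M' (tmp k) = loc a (M (tmp k)) /\ keeps k M M'.
Proof.
split.
  rewrite /address /= /mexec /= /upd !eqxx !tmp_neq /= ?(gtn_eqF (ltnSn k)) ?(ltn_eqF (ltnSn k))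
    /loc; lia.
by rewrite /address /= /mexec /=; do ?[apply: keeps_trans (keeps_upd _ _ _); last lia].
Qed.

Lemma straight_cexpr k e : all straight (cexpr k e).
Proof.
by elim: e k => [n|e1 H1 e2 H2|e1 H1 e2 H2|a e H] k //=; rewrite !all_cat ?H1 ?H2 ?H.
Qed.

(** Makes the running time independent of the first temporary in use. *)
Lemma size_cexpr k e : size (cexpr k e) = size (cexpr 0 e).
Proof.
elim: e k => [n|e1 H1 e2 H2|e1 H1 e2 H2|a e H] k //=; rewrite !size_cat /= ?(H k) //.
  by rewrite (H1 k) (H2 k.+1) (H2 1).
by rewrite (H1 k) (H2 k.+1) (H2 1).
Qed.

Lemma cexpr_ok e k M S : wfe e -> represents M S ->
  let M' := foldl mexec M (cexpr k e) in M' (tmp k) = ev e S /\ keeps k M M'.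
Proof.
elim: e k M => [n|e1 H1 e2 H2|e1 H1 e2 H2|a e H] k M.
- by move=> _ _; cbn zeta; rewrite /mexec /= /upd eqxx; split=> //; apply: keeps_upd.
- case/andP=> w1 w2 R; cbn zeta; rewrite [cexpr k _]/= !foldl_cat.
  have [V1 K1] := H1 k M w1 R; have R1 := keeps_represents K1 R.
  have [V2 K2] := H2 k.+1 _ w2 R1.
  rewrite /mexec /= {1}/upd eqxx V2 (keeps_tmp K2 (ltnSn k)) V1; split=> //.
  by apply: keeps_trans (keeps_upd _ _ (leqnn k)); apply: keeps_trans K1 (keepsS K2).
- case/andP=> w1 w2 R; cbn zeta; rewrite [cexpr k _]/= !foldl_cat.
  have [V1 K1] := H1 k M w1 R; have R1 := keeps_represents K1 R.
  have [V2 K2] := H2 k.+1 _ w2 R1.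
  rewrite /mexec /= {1}/upd eqxx V2 (keeps_tmp K2 (ltnSn k)) V1; split=> //.
  by apply: keeps_trans (keeps_upd _ _ (leqnn k)); apply: keeps_trans K1 (keepsS K2).
case/andP=> a31 we R; cbn zeta.
rewrite -[cexpr k _]/(cexpr k e ++ (address k a ++ [:: ILoad (tmp k) (tmp k)])).
rewrite foldl_cat (foldl_cat _ _ (address k a)).
have [V1 K1] := H k M we R; have R1 := keeps_represents K1 R.
have [V2 K2] := address_ok k a (foldl mexec M (cexpr k e)).
set M2 := foldl mexec _ (address k a) in V2 K2 *.
clearbody M2; rewrite /mexec /= {1}/upd eqxx V2 V1; split.
  by have /(_ a _ a31) -> := keeps_represents K2 R1.
by apply: keeps_trans (keeps_upd _ _ (leqnn k)); apply: keeps_trans K1 K2.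
Qed.

(** Concerns the limits met in the actual run from [S]; [time] replaces each of them by one
    polynomial [b] in the input size. *)
Fixpoint bounded (B : nat) (c : cmd) (S : state) : Prop :=
  match c with
  | Put _ _ _ | Read _ => True
  | Seq c1 c2 => bounded B c1 S /\ bounded B c2 (den c1 S)
  | When e c1 => 0 < ev e S -> bounded B c1 S
  | For x y c1 => arr S y 0 <= B /\
      forall i, i < arr S y 0 ->
        bounded B c1 (put (loop (fun i S' => den c1 (put S' x 0 i)) i S) x 0 i)
  end.

Definition esize (e : expr) : nat := size (cexpr 0 e).

(** The constants count the instructions around the compiled parts: 6 steps per round of a loop
    besides its body, and 5 for setting it up and for its last test. *)
Fixpoint time (c : cmd) (b : {poly nat}) : {poly nat} :=
  match c with
  | Put _ e1 e2 => (esize e1 + esize e2 + 8)%N%:P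
  | Read _ => 1%:P
  | Seq c1 c2 => time c1 b + time c2 b
  | When e c1 => (esize e + 3)%N%:P + time c1 b
  | For _ _ c1 => 5%N%:P + b * (time c1 b + 6%N%:P)
  end%R.

Lemma loc_eq a i b j : a < 32 -> b < 32 -> (loc a i == loc b j) = (a == b) && (i == j).
Proof. by move=> a32 b32; rewrite /loc; apply/eqP/andP => [?|[/eqP-> /eqP->]//]; split;
  apply/eqP; lia. Qed.

Lemma represents_put M S a i v : a < 31 -> represents M S ->
  represents (upd M (loc a i) v) (put S a i v).
Proof.
move=> a31 R b j b31; rewrite /upd /put /upd2 /= loc_eq ?(leqW a31) ?(leqW b31) //.
by case: ifP => // _; apply: R.
Qed.

Lemma iter_trans (f : config -> config) t1 t2 x y z :
  iter t1 f x = y -> iter t2 f y = z -> iter (t1 + t2) f x = z.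
Proof. by move=> <- <-; rewrite addnC iterD. Qed.

(** Jump targets are absolute, so the code is compiled for its position [size pre] and the induction
    ranges over all surroundings [pre] and [post]. The temporaries below [k] must survive because
    they hold the counters of the enclosing loops. *)
Lemma ccmd_ok (b : {poly nat}) s c : wf c -> forall pre post k M S,
  bounded b.[s]%R c S -> represents M S ->
  let code := ccmd (size pre) k c in
  exists t M', [/\ iter t (step (pre ++ code ++ post)) (Config (size pre) M (inp S)) =
      Config (size pre + size code) M' (inp (den c S)),
    represents M' (den c S),
    forall j, j < k -> M' (tmp j) = M (tmp j) &
    t <= (time c b).[s]%R].
Proof.
elim: c => [a e1 e2|x|c1 H1 c2 H2|e c1 H1|x y c1 H1].
- case/and3P=> a31 w1 w2 pre post k M S _ R; cbn zeta.
  rewrite -[ccmd _ _ _]/(cexpr k e1 ++ (address k a ++ (cexpr k.+1 e2 ++ [:: IStore (tmp k) (tmp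
    k.+1)]))).
  have [V1 K1] := cexpr_ok k w1 R; have R1 := keeps_represents K1 R.
  have [V2 K2] := address_ok k a (foldl mexec M (cexpr k e1)); have R2 := keeps_represents K2 R1.
  have [V3 K3] := cexpr_ok k.+1 w2 R2; have R3 := keeps_represents K3 R2.
  eexists; eexists; split.
  + by apply: iter_straight; rewrite !all_cat !straight_cexpr.
  + rewrite foldl_cat (foldl_cat _ _ (address k a)) foldl_cat;
      set M3 := foldl mexec _ (cexpr k.+1 e2) in V3 K3 R3 *; clearbody M3.
    rewrite /= /mexec /= V3 (keeps_tmp K3 (ltnSn k)) V2 V1.
    exact: represents_put.
  + rewrite foldl_cat (foldl_cat _ _ (address k a)) foldl_cat => j jk;
      set M3 := foldl mexec _ (cexpr k.+1 e2) in V3 K3 R3 *; clearbody M3.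
    rewrite /= /mexec /= V3 (keeps_tmp K3 (ltnSn k)) V2 V1 /upd loc_eq ?(leqW a31) //.
    rewrite (gtn_eqF a31) /= (keeps_tmp K3 (ltnW _)) // (keeps_tmp K2) //.
    by rewrite (keeps_tmp K1).
  + rewrite !size_cat (size_cexpr k) (size_cexpr k.+1) /= hornerC /esize; lia.
- rewrite /= => x31 pre post k M S _ R; exists 1; eexists; split.
  + by rewrite /= /step /halted size_cat /= -[X in _ <= X]addn0 leq_add2l /= nth_cat ltnn subnn
      /= addn1.
  + have := represents_put 0 (head 0 (inp S)) x31 R; rewrite /loc muln0 addn0.
    exact.
  + by move=> j jk; rewrite /= /upd /loc; case: eqP => //; lia.
  + by rewrite /= hornerC.
- case/andP=> w1 w2 pre post k M S [b1 b2] R; cbn zeta.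
  rewrite -[ccmd _ _ _]/(ccmd (size pre) k c1 ++ ccmd (size pre + size (ccmd (size pre) k c1)) k
    c2).
  have [t1 [M1 [E1 R1 K1 T1]]] := H1 w1 pre (ccmd (size pre + size (ccmd (size pre) k c1)) k c2
    ++ post) k M S b1 R.
  have := H2 w2 (pre ++ ccmd (size pre) k c1) post k M1 _ b2 R1.
  rewrite /= size_cat -!catA => -[t2 [M2 [E2 R2 K2 T2]]].
  exists (t1 + t2), M2; split=> //.
  + by apply: iter_trans E1 _; rewrite E2 !size_cat addnA.
  + by move=> j jk; rewrite K2 ?K1.
  + by rewrite /= hornerD leq_add.
- case/andP=> we w1 pre post k M S b1 R; cbn zeta.
  (* The machine jumps on positive values only; skipping the body is thus decided by
     [1 - ev e S]. *)
  set s1 := cexpr k e ++ [:: IConst (tmp k.+1) 1; ISub (tmp k) (tmp k.+1) (tmp k)].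
  set body := ccmd (size pre + size s1).+1 k c1.
  have -> : ccmd (size pre) k (When e c1) =
    s1 ++ IJpos (tmp k) ((size pre + size s1).+1 + size body) :: body by [].
  have st1 : all straight s1 by rewrite all_cat straight_cexpr.
  have E1 := iter_straight pre (IJpos (tmp k) ((size pre + size s1).+1 + size body) :: body ++
    post) M (inp S) st1.
  have [V K] := cexpr_ok k we R.
  have KV : foldl mexec M s1 (tmp k) = 1 - ev e S /\ keeps k M (foldl mexec M s1).
    rewrite /s1 foldl_cat; set M1 := foldl mexec M _ in V K *; clearbody M1.
    rewrite /= /mexec /= /upd !tmp_neq !eqxx (ltn_eqF (ltnSn k)) V; split=> //.
    by do 2![apply: keeps_trans (keeps_upd _ _ _); last lia].
  case: KV => V1 K1; have R1 := keeps_represents K1 R.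
  set M1 := foldl mexec M s1 in E1 V1 K1 R1 *.
  have szs : size s1 = size (cexpr k e) + 2 by rewrite size_cat.
  have sz : (size s1 <= esize e + 2) by rewrite /s1 size_cat size_cexpr.
  have E2 := step_jump (pre ++ s1) (body ++ post) (tmp k) ((size pre + size s1).+1 + size body)
    M1 (inp S).
  rewrite V1 subn_gt0 size_cat -catA in E2.
  rewrite /= -/M1; case: (posnP (ev e S)) => [e0|e_gt0].
    exists (size s1 + 1), M1; split=> //.
    + rewrite -catA; apply: iter_trans E1 _; rewrite /= E2 e0 /=.
      by congr Config; rewrite size_cat szs /=; lia.
    + by move=> j jk; rewrite (keeps_tmp K1).
    + by rewrite hornerD hornerC; lia.
  have := H1 w1 (pre ++ s1 ++ [:: IJpos (tmp k) ((size pre + size s1).+1 + size body)]) post k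
    M1 S (b1 e_gt0) R1.
  have -> : size (pre ++ s1 ++ [:: IJpos (tmp k) ((size pre + size s1).+1 + size body)]) = (size
    pre + size s1).+1.
    by rewrite !size_cat addnA addn1.
  rewrite -/body => -[t [M2 [E3 R2 K2 T2]]].
  exists (size s1 + (1 + t)), M2; split=> //.
  + rewrite -catA; apply: iter_trans E1 _; apply: (iter_trans (t1 := 1) E2).
    rewrite ltnNge e_gt0 /=; move: E3; rewrite -!catA /= => ->.
    by congr Config; rewrite size_cat szs /=; lia.
  + by move=> j jk; rewrite K2 // (keeps_tmp K1).
  + by rewrite hornerD hornerC; lia.
case/and3P=> x31 y31 w1 pre post k M S [bN b1] R; cbn zeta.
set body := ccmd (size pre + 6) k.+2 c1.
(* Position of the closing jump of the loop. The loop is entered there, so that a limit 0 is handled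
   as well. *)
set test := size pre + 6 + size body + 3.
set a0 := IConst (tmp k.+1) 0; set a1 := IAdd (tmp k) y (tmp k.+1).
set a2 := IConst (tmp k.+2) 1; set a3 := IJpos (tmp k.+2) test.
set a4 := IConst (tmp k.+2) 0; set a5 := IAdd x (tmp k.+1) (tmp k.+2).
set b1' := IAdd (tmp k.+1) (tmp k.+1) (tmp k.+2); set b2 := ISub (tmp k) (tmp k) (tmp k.+2).
set b3 := IJpos (tmp k) (size pre + 4).
have -> : ccmd (size pre) k (For x y c1) =
  [:: a0; a1; a2; a3; a4; a5] ++ body ++ [:: a2; b1'; b2; b3] by [].
set P := pre ++ _ ++ post.
have szc : size ([:: a0; a1; a2; a3; a4; a5] ++ body ++ [:: a2; b1'; b2; b3]) = size body + 10.
  by rewrite /= size_cat /=; lia.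
rewrite szc; set N := arr S y 0 in bN b1 *; set T := (time c1 b).[s]%R.
set f := fun i S' => den c1 (put S' x 0 i).
have -> : den (For x y c1) S = loop f N S by [].
(* Induction on the number [r] of rounds left, always starting from the test. *)
have main r : forall i M0, i + r = N -> represents M0 (loop f i S) -> M0 (tmp k) = r ->
    M0 (tmp k.+1) = i -> (forall j, j < k -> M0 (tmp j) = M (tmp j)) ->
    exists t M', [/\ iter t (step P) (Config test M0 (inp (loop f i S))) =
        Config (size pre + (size body + 10)) M' (inp (loop f N S)),
      represents M' (loop f N S), forall j, j < k -> M' (tmp j) = M (tmp j) &
      t <= r * (T + 6) + 1].
  pose pre4 := pre ++ [:: a0; a1; a2; a3; a4; a5] ++ body ++ [:: a2; b1'; b2].
  have EP4 : P = pre4 ++ b3 :: post by rewrite /P /pre4 -!catA.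
  have sz4 : size pre4 = test by rewrite /pre4 /test !size_cat /=; lia.
  elim: r => [|r IHr] i M0 iN R0 Mk Mk1 low.
    exists 1, M0; rewrite /= -iN addn0; split=> //.
    rewrite EP4 -sz4 step_jump Mk /=; congr Config; rewrite sz4 /test; lia.
  have E1 : iter 1 (step P) (Config test M0 (inp (loop f i S))) =
      Config (size pre + 4) M0 (inp (loop f i S)).
    by rewrite /= EP4 -sz4 step_jump Mk.
  pose pre1 := pre ++ [:: a0; a1; a2; a3].
  have EP1 : P = pre1 ++ [:: a4; a5] ++ (body ++ [:: a2; b1'; b2; b3]) ++ post.
    by rewrite /P /pre1 -!catA.
  have sz1 : size pre1 = size pre + 4 by rewrite size_cat.
  have E2 := iter_straight pre1 ((body ++ [:: a2; b1'; b2; b3]) ++ post) M0 (inp (loop f i S))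
    (isT : all straight [:: a4; a5]).
  set M1 := foldl mexec M0 [:: a4; a5] in E2.
  have x0 : x = loc x 0 by rewrite /loc muln0 addn0.
  have k01 : (k.+1 == k.+2) = false by apply/eqP; lia.
  have k02 : (k == k.+2) = false by apply/eqP; lia.
  have k10 : (k.+2 == k.+1) = false by apply/eqP; lia.
  have k12 : (k == k.+1) = false by apply/eqP; lia.
  have k13 : (k.+1 == k) = false by apply/eqP; lia.
  have xt j : (tmp j == x) = false.
    by rewrite {1}x0 loc_eq ?(leqW x31) // (gtn_eqF x31).
  have M1E : M1 = upd (upd M0 (tmp k.+2) 0) x i.
    by rewrite /M1 /= /mexec /= /upd eqxx !tmp_neq k01 Mk1 addn0.
  have R1 : represents M1 (put (loop f i S) x 0 i).
    have := @represents_put (upd M0 (tmp k.+2) 0) (loop f i S) x 0 i x31.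
    rewrite -x0 -M1E; apply.
    by apply: keeps_represents R0; apply: (keeps_upd (k := k.+2)).
  have iN' : i < N by lia.
  pose pre2 := pre1 ++ [:: a4; a5].
  have sz2 : size pre2 = size pre + 6 by rewrite size_cat sz1 -addnA.
  have EP2 : P = pre2 ++ body ++ ([:: a2; b1'; b2; b3] ++ post).
    by rewrite /P /pre2 /pre1 -!catA.
  have [t [M2 [E3 R2 K2 T2]]] :=
    H1 w1 pre2 ([:: a2; b1'; b2; b3] ++ post) k.+2 M1 _ (b1 i iN') R1.
  rewrite sz2 -/body -EP2 in E3.
  pose pre3 := pre2 ++ body.
  have sz3 : size pre3 = size pre + 6 + size body by rewrite size_cat sz2.
  have EP3 : P = pre3 ++ [:: a2; b1'; b2] ++ (b3 :: post).
    by rewrite /P /pre3 /pre2 /pre1 -!catA.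
  have E4 := iter_straight pre3 (b3 :: post) M2 (inp (loop f i.+1 S))
    (isT : all straight [:: a2; b1'; b2]).
  set M3 := foldl mexec M2 [:: a2; b1'; b2] in E4.
  have M2k : M2 (tmp k) = r.+1 by rewrite K2 // M1E /upd xt tmp_neq k02.
  have M2k1 : M2 (tmp k.+1) = i by rewrite K2 // M1E /upd xt tmp_neq k01.
  have M3E : M3 = upd (upd (upd M2 (tmp k.+2) 1) (tmp k.+1) i.+1) (tmp k) r.
    rewrite /M3 /= /mexec /= /upd !eqxx !tmp_neq k01 k02 k10 k12 M2k1 M2k.
    by rewrite subn1 addn1.
  have R3 : represents M3 (loop f i.+1 S).
    rewrite M3E; do 3!apply: (keeps_represents (keeps_upd _ _ (leq0n _))).
    exact: R2.
  have [||||t' [M' [E5 R' K' T']]] := IHr i.+1 M3 _ R3.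
  - by rewrite addSnnS.
  - by rewrite M3E /upd eqxx.
  - by rewrite M3E /upd !tmp_neq k13 eqxx.
  - move=> j jk; rewrite M3E /upd !tmp_neq !ltn_eqF ?K2 ?M1E /upd ?xt ?tmp_neq ?ltn_eqF ?low //;
      lia.
  exists (1 + (2 + (t + (3 + t')))), M'; split=> //; last first.
    by move: T' T2; rewrite -/T; lia.
  apply: iter_trans E1 _.
  rewrite -EP1 sz1 in E2; apply: (iter_trans (t1 := 2) E2).
  rewrite -addnA; apply: iter_trans E3 _.
  rewrite -EP3 sz3 in E4; apply: (iter_trans (t1 := 3) E4).
  exact: E5.
have E1 := iter_straight pre (a3 :: [:: a4; a5] ++ (body ++ [:: a2; b1'; b2;
  b3]) ++ post) M (inp S)
    (isT : all straight [:: a0; a1; a2]).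
set M1 := foldl mexec M [:: a0; a1; a2] in E1.
have E2 := step_jump (pre ++ [:: a0; a1; a2]) ([:: a4; a5] ++ (body ++ [:: a2; b1'; b2;
  b3]) ++ post)
   (tmp k.+2) test M1 (inp S).
have y0 : y = loc y 0 by rewrite /loc muln0 addn0.
have yt j : (y == tmp j) = false.
  by rewrite {1}y0 loc_eq ?(leqW y31) // (ltn_eqF y31).
have M1E : M1 = upd (upd (upd M (tmp k.+1) 0) (tmp k) N) (tmp k.+2) 1.
  by rewrite /M1 /= /mexec /= /upd eqxx yt addn0 {1}y0 R.
have R1 : represents M1 S.
  by rewrite M1E; do 3!apply: (keeps_represents (keeps_upd _ _ (leq0n _))).
have [||||t [M' [E3 R' K' T']]] := main N 0 M1 _ R1.
- by [].
- by rewrite M1E /upd !tmp_neq eqxx; case: eqP => //; lia.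
- by rewrite M1E /upd !tmp_neq eqxx; do 2![case: eqP => //; try lia].
- by move=> j jk; rewrite M1E /upd !tmp_neq !ltn_eqF //; lia.
exists (3 + (1 + t)), M'; split=> //.
- apply: (iter_trans (t1 := 3) E1); apply: (iter_trans (t1 := 1) _ E3).
  move: E2; rewrite size_cat -catA /= => ->.
  by rewrite M1E /upd eqxx.
rewrite /= !(hornerD, hornerM, hornerC) -/T.
have : (N * (T + 6) <= b.[s]%R * (T + 6))%N by rewrite leq_mul2r bN orbT.
have -> : (5%N + b.[s] * (T + 6%N))%R = (5 + b.[s]%R * (T + 6))%N by [].
by move: T'; move: (N * _)%N (b.[s]%R * _)%N => u v; lia.
Qed.

(** * Numerical codes of vertex sets *)

Lemma sum_digits_lt b n (f : nat -> nat) : (forall i, f i < b) ->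
  \sum_(i < n) f i * b ^ i < b ^ n.
Proof.
move=> fb; elim: n => [|n IHn]; first by rewrite big_ord0.
rewrite big_ord_recr /= expnS; have := fb n.
by move: IHn; set u := \sum_(_ < _) _; set c := b ^ n; nia.
Qed.

Lemma sum_digits_inj b n (f g : nat -> nat) :
  (forall i, f i < b) -> (forall i, g i < b) ->
  \sum_(i < n) f i * b ^ i = \sum_(i < n) g i * b ^ i ->
  forall i, i < n -> f i = g i.
Proof.
move=> fb gb; elim: n => // n IHn; rewrite !big_ord_recr /= !(addnC (\sum_(_ < _) _)) => E i.
have lf := sum_digits_lt n fb; have lg := sum_digits_lt n gb.
have b_gt0 : 0 < b ^ n by apply: leq_trans lf.
have fgn : f n = g n.
  have := congr1 (divn^~ (b ^ n)) E.
  by rewrite !divnMDl // !divn_small // !addn0.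
rewrite ltnS leq_eqVlt => /orP[/eqP-> //|]; apply: IHn.
by move: E; rewrite fgn => /addnI.
Qed.

Section Codes.
Variable G : sgraph.
Implicit Types (A B Z : {set G}) (v : G).

Definition rk v : nat := enum_rank v.

Lemma rk_lt v : rk v < #|G|.
Proof. exact: ltn_ord. Qed.

Lemma rk_inj : injective rk.
Proof. by move=> u v /ord_inj /enum_rank_inj. Qed.

Lemma rkP i : i < #|G| -> {v | i = rk v}.
Proof. by move=> lt; exists (enum_val (Ordinal lt)); rewrite /rk enum_valK. Qed.

Definition digit A (i : nat) : bool := [exists v, (rk v == i) && (v \in A)].

Lemma digit_rk A v : digit A (rk v) = (v \in A).
Proof.
apply/existsP/idP => [[u /andP[/eqP/rk_inj->]]//|vA].
by exists v; rewrite eqxx.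
Qed.

(* In base 4, adding two codes produces no carry, and the sum is again a code
   if and only if the two sets are disjoint. *)
Definition code A : nat := \sum_(i < #|G|) digit A i * 4 ^ i.

Lemma code_lt A : code A < 4 ^ #|G|.
Proof. by apply: (@sum_digits_lt 4 _ (digit A)) => i; case: (digit A i). Qed.

Lemma code_inj : injective code.
Proof.
move=> A B E; apply/setP => v; rewrite -!digit_rk.
have db (Z : {set G}) i : digit Z i < 4 by case: (digit Z i).
have := @sum_digits_inj 4 #|G| (digit A) (digit B) (db A) (db B) E _ (rk_lt v).
by case: digit; case: digit.
Qed.

Lemma code0 : code set0 = 0.
Proof.
rewrite /code big1 // => i _; have [v ->] := rkP (ltn_ord i).
by rewrite digit_rk inE.
Qed.

Lemma code1 v : code [set v] = 4 ^ rk v.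
Proof.
rewrite /code (bigD1 (Ordinal (rk_lt v))) //= digit_rk set11 mul1n big1 ?addn0 // => i ne.
have [u Ei] := rkP (ltn_ord i); rewrite Ei digit_rk inE.
by case: eqP => // uv; move: ne; rewrite -val_eqE /= Ei uv eqxx.
Qed.

Lemma codeU A B : [disjoint A & B] -> code A + code B = code (A :|: B).
Proof.
move=> dAB; rewrite /code -big_split; apply: eq_bigr => i _ /=.
have [v ->] := rkP (ltn_ord i); rewrite !digit_rk inE.
by have [vA|] := boolP (v \in A); rewrite ?(disjointFr dAB vA) ?addn0.
Qed.

(** The digits of the sum are at most 2, so both sides agree digit by digit; since those of [code Z]
    are 0 or 1, no vertex is counted twice. *)
Lemma codeD_inv A B Z : code A + code B = code Z -> [disjoint A & B] /\ A :|: B = Z.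
Proof.
rewrite /code -big_split /= => E.
have db i : digit A i + digit B i < 4 by case: (digit A i); case: (digit B i).
have dz i : digit Z i < 4 by case: (digit Z i).
have {}E v : (v \in A) + (v \in B) = (v \in Z) :> nat.
  rewrite -!digit_rk; apply: (@sum_digits_inj 4 #|G| (fun i =>
    digit A i + digit B i) (digit Z)) (rk_lt v) => //.
  by rewrite -E; apply: eq_bigr => i _; rewrite mulnDl.
split; last by apply/setP => v; move: (E v); rewrite inE; do 3![case: (v \in _)].
by rewrite -setI_eq0; apply/eqP/setP => v; move: (E v); rewrite !inE; do 3![case: (v \in _)].
Qed.

(** Address of a set paired with the rank [x] of a vertex or colour. Codes stay below [4 ^ #|G|], so
    distinct pairs have distinct addresses, and one addition computes them once the multiples of
    [4 ^ #|G|] are tabulated. *)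
Definition idx A (x : nat) : nat := code A + 4 ^ #|G| * x.

Lemma idx_inj A B x y : idx A x = idx B y -> A = B /\ x = y.
Proof.
rewrite /idx ![code _ + _]addnC ![_ * x]mulnC ![_ * y]mulnC => E.
have p0 : 0 < 4 ^ #|G| by rewrite expn_gt0.
have xy : x = y.
  have := congr1 (divn^~ (4 ^ #|G|)) E.
  by rewrite !divnMDl // !divn_small ?code_lt // !addn0.
by split=> //; apply: code_inj; move: E; rewrite xy => /addnI.
Qed.
End Codes.

(** * Semantics of loops and frames *)

Lemma loop_ind (P : nat -> state -> Prop) f n S :
  P 0 S -> (forall i S', i < n -> P i S' -> P i.+1 (f i S')) -> P n (loop f n S).
Proof.
move=> P0 PS; elim: n PS => //= n IHn PS; apply: (PS n) => //.
by apply: IHn => i S' lt; apply: PS; apply: ltnW.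
Qed.

Fixpoint writes (c : cmd) : seq nat :=
  match c with
  | Put a _ _ => [:: a]
  | Read x => [:: x]
  | Seq c1 c2 => writes c1 ++ writes c2
  | When _ c1 => writes c1
  | For x _ c1 => x :: writes c1
  end.

Fixpoint limits (c : cmd) : seq nat :=
  match c with
  | Put _ _ _ | Read _ => [::]
  | Seq c1 c2 => limits c1 ++ limits c2
  | When _ c1 => limits c1
  | For _ y c1 => y :: limits c1
  end.

Lemma upd2_neq M a i v b j : b != a -> upd2 M a i v b j = M b j.
Proof. by rewrite /upd2 => /negPf->. Qed.

Lemma arr_put S a i v b j : b != a -> arr (put S a i v) b j = arr S b j.
Proof. exact: upd2_neq. Qed.

Lemma den_frame c S a i : a \notin writes c -> arr (den c S) a i = arr S a i.
Proof.
elim: c S => [b e1 e2|x|c1 H1 c2 H2|e c1 H1|x y c1 H1] S /=.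
- by rewrite inE; apply: upd2_neq.
- by rewrite inE; apply: upd2_neq.
- by rewrite mem_cat negb_or => /andP[/H1 E1 /H2 E2]; rewrite E2 E1.
- by case: ifP => // _; apply: H1.
rewrite inE negb_or => /andP[ax ac].
apply: (loop_ind (P := fun _ S' => arr S' a i = arr S a i)) => // k S' _ <-.
by rewrite H1 // arr_put.
Qed.

(** Limits that the command never writes keep their initial values throughout the run. *)
Lemma bounded_limits B c S :
  (forall y, y \in limits c -> y \notin writes c /\ arr S y 0 <= B) -> bounded B c S.
Proof.
(* [W] stands for the writes of the whole command: a limit must survive not only its own loop, but
   also preceding commands and earlier rounds of enclosing loops. *)
suff H (W : seq nat) : {subset writes c <= W} ->
    (forall y, y \in limits c -> y \notin W /\ arr S y 0 <= B) -> bounded B c S.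
  exact: H.
elim: c S => [b e1 e2|x|c1 H1 c2 H2|e c1 H1|x y c1 H1] S //= sW lim.
- have sW1 : {subset writes c1 <= W} by move=> a ac; apply: sW; rewrite mem_cat ac.
  split; first by apply: H1 => // y yc; apply: lim; rewrite mem_cat yc.
  have sW2 : {subset writes c2 <= W} by move=> a ac; apply: sW; rewrite mem_cat ac orbT.
  apply: H2 => // y yc.
  have [|yW yB] := lim y; first by rewrite mem_cat yc orbT.
  by rewrite den_frame //; apply: contra yW => /sW1.
- by move=> _; apply: H1.
have sW1 : {subset writes c1 <= W} by move=> a ac; apply: sW; rewrite inE ac orbT.
have [yW yB] := lim y (mem_head _ _); split=> // i _.
have frame : forall a, a \notin W ->
    arr (loop (fun i S' => den c1 (put S' x 0 i)) i S) a 0 = arr S a 0.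
  move=> a aW; have aneq : a != x by apply: contra aW => /eqP->; apply: sW; rewrite mem_head.
  apply: (loop_ind (P := fun _ S' => arr S' a 0 = arr S a 0)) => // k S' _ <-.
  by rewrite den_frame ?arr_put //; apply: contra aW => /sW1.
apply: H1 => // z zc; have [|zW zB] := lim z; first by rewrite inE zc orbT.
split=> //; rewrite arr_put ?frame //.
by apply: contra zW => /eqP->; apply: sW; rewrite mem_head.
Qed.

(** * The program *)

Notation Var x := (EGet x (ENum 0)).
Notation "x <~ e" := (Put x (ENum 0) e) (at level 70).
Notation "c1 ;; c2" := (Seq c1 c2) (at level 90, right associativity).
Infix "+:" := EAdd (at level 50, left associativity).
Infix "-:" := ESub (at level 50, left associativity).

Notation v_out := 0.
Notation v_n := 1.
Notation v_m := 2.
Notation v_nm := 3.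
Notation v_N := 4.
Notation v_n1 := 5.
Notation v_acc := 6.
Notation v_i := 7.
Notation v_j := 8.
Notation v_u := 9.
Notation v_v := 10.
Notation v_d := 11.
Notation v_e := 12.
Notation v_x := 13.
Notation v_pow := 14.
Notation v_ev := 15.
Notation v_base := 16.
Notation v_z := 17.
Notation v_cnt := 18.
Notation v_cl := 19.
Notation v_tgt := 20.
Notation v_r := 21.
(* [a_pw] and [a_de] hold powers of 4 and multiples of 4 ^ n; [a_nb] and [a_in]
   tell, at the address of a set and a vertex, whether the vertex is adjacent to
   the set and whether it belongs to it; [a_L] lists the codes of the connected
   sets found so far (followed by 0, the code of the empty set), and [a_mk] marks
   these codes; [a_T] holds 1 plus the best value found so far, or 0 if none. *)
Notation a_pw := 23.
Notation a_de := 24.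
Notation a_nb := 25.
Notation a_in := 26.
Notation a_L := 27.
Notation a_mk := 28.
Notation a_T := 29.
Notation a_ans := 30.

Definition multiply : cmd :=
  v_acc <~ ENum 0 ;; For v_i v_n1 (v_acc <~ Var v_acc +: Var v_N) ;; v_N <~ Var v_acc.

Definition header (c : nat) : cmd :=
  Read v_n ;; Read v_m ;; v_nm <~ Var v_n +: Var v_m ;;
  v_n1 <~ Var v_n +: ENum 1 ;; v_N <~ ENum c.

Definition fill_pw : cmd :=
  v_pow <~ ENum 1 ;;
  For v_i v_n (Put a_pw (Var v_i) (Var v_pow) ;;
               v_pow <~ Var v_pow +: Var v_pow +: Var v_pow +: Var v_pow).

(** [fill_pw] leaves [4 ^ n] in [v_pow]. The table has [n + m] entries because ranks of vertices and
    of colours both serve as offsets. *)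
Definition fill_de : cmd :=
  v_ev <~ ENum 0 ;;
  For v_i v_nm (Put a_de (Var v_i) (Var v_ev) ;; v_ev <~ Var v_ev +: Var v_pow).

Definition read_adj : cmd :=
  For v_u v_n (For v_v v_n (Read v_x ;;
    Put a_nb (EGet a_pw (Var v_u) +: EGet a_de (Var v_v)) (Var v_x))).

(** The first loop skips the listing of the colour-set. In the second, an entry 1 stands for cost
    0. *)
Definition read_colours : cmd :=
  For v_i v_m (Read v_x) ;;
  For v_v v_n (Read v_x ;;
    Put a_T (EGet a_pw (Var v_v) +: EGet a_de (Var v_x)) (ENum 1)).

(** The neighbour row of [v |: A] is the sum of those of [A] and [[set v]]; only the positivity of
    its entries matters. *)
Definition copy_row : cmd :=
  For v_j v_n (
    Put a_nb (Var v_z +: EGet a_de (Var v_j))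
      (EGet a_nb (Var v_base +: EGet a_de (Var v_j)) +:
       EGet a_nb (EGet a_pw (Var v_v) +: EGet a_de (Var v_j))) ;;
    Put a_in (Var v_z +: EGet a_de (Var v_j))
      (EGet a_in (Var v_base +: EGet a_de (Var v_j)))).

Definition add_set : cmd :=
  v_z <~ Var v_base +: EGet a_pw (Var v_v) ;;
  When (ENum 1 -: EGet a_mk (Var v_z)) (
    copy_row ;;
    Put a_in (Var v_z +: EGet a_de (Var v_v)) (ENum 1) ;;
    Put a_L (Var v_cnt) (Var v_z) ;;
    Put a_mk (Var v_z) (ENum 1) ;;
    v_cnt <~ Var v_cnt +: ENum 1).

Definition nb_test (base : expr) (c : cmd) : cmd :=
  When (EGet a_nb (base +: EGet a_de (Var v_v)))
    (When (ENum 1 -: EGet a_in (base +: EGet a_de (Var v_v))) c).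

(** Singletons are treated as extensions of the empty set, whose code is 0 and whose rows are
    zero. *)
Definition add_singletons : cmd := For v_v v_n (v_base <~ ENum 0 ;; add_set).

Definition extend_row : cmd :=
  v_base <~ EGet a_L (Var v_i) ;; For v_v v_n (nb_test (Var v_base) add_set).

(** The list is a queue, scanned while it grows. Positions past its end hold 0, the code of the
    empty set, which has no neighbours to add. *)
Definition enumerate : cmd := add_singletons ;; For v_i v_N extend_row.

(* The first summand tests whether the entry is still empty. *)
Definition relax (k v : expr) : cmd :=
  When ((ENum 1 -: EGet a_T k) +: (EGet a_T k -: v)) (Put a_T k v).

Definition T_at (l d : nat) : expr := EGet a_L (Var l) +: EGet a_de (Var d).

(** Entries exceed costs by 1, so one of the two extra units is taken off the sum. *)
Definition join_cell : cmd :=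
  When (EGet a_T (T_at v_i v_d)) (When (EGet a_T (T_at v_j v_d)) (
    relax (EGet a_L (Var v_i) +: T_at v_j v_d)
      (EGet a_T (T_at v_i v_d) +: EGet a_T (T_at v_j v_d) -: ENum 1))).

Definition join_pair : cmd :=
  When (EGet a_mk (EGet a_L (Var v_i) +: EGet a_L (Var v_j))) (For v_d v_m join_cell).

Definition join_pairs : cmd := For v_i v_N (For v_j v_N join_pair).

Definition recolour_cell : cmd :=
  When (EGet a_T (T_at v_i v_d)) (
    For v_e v_m (relax (T_at v_i v_e) (EGet a_T (T_at v_i v_d) +: ENum 1))).

Definition recolour : cmd := For v_i v_N (For v_d v_m recolour_cell).

Definition optimise : cmd := For v_r v_n (join_pairs ;; recolour).

Definition saturation_test : cmd :=
  v_cl <~ ENum 1 ;; For v_v v_n (nb_test (EGet a_L (Var v_i)) (v_cl <~ ENum 0)).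

(** The listed sets without outside neighbours are the components of the graph. A position past the
    end stands for the empty set, which also passes the test, but its entries are 0 and contribute
    [0 - 1 = 0]. *)
Definition collect : cmd :=
  For v_i v_N (saturation_test ;; When (Var v_cl) (For v_d v_m (
    Put a_ans (Var v_d) (EGet a_ans (Var v_d) +: (EGet a_T (T_at v_i v_d) -: ENum 1))))).

(** * Invariants of the memory *)

Section Correctness.
Variables (G : sgraph) (C : finType) (w : {ffun G -> C}) (N : nat).
Implicit Types (A B Z : {set G}) (u v : G) (d e : C) (S : state).

Notation n := #|G|.
Notation m := #|C|.

Definition crk d : nat := enum_rank d.

Lemma crk_lt d : crk d < m.
Proof. exact: ltn_ord. Qed.

Lemma crk_inj : injective crk.
Proof. by move=> d e /ord_inj /enum_rank_inj. Qed.

Lemma crkP i : i < m -> {d | i = crk d}.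
Proof. by move=> lt; exists (enum_val (Ordinal lt)); rewrite /crk enum_valK. Qed.

Record env S : Prop := Env {
  env_n : arr S v_n 0 = n;
  env_m : arr S v_m 0 = m;
  env_nm : arr S v_nm 0 = n + m;
  env_N : arr S v_N 0 = N;
  env_pw : forall i, i < n -> arr S a_pw i = 4 ^ i;
  env_de : forall i, i < n + m -> arr S a_de i = 4 ^ n * i
}.

Definition env_ids : seq nat := [:: v_n; v_m; v_nm; v_N; a_pw; a_de].

Lemma env_eq S S' : (forall a i, a \in env_ids -> arr S' a i = arr S a i) ->
  env S -> env S'.
Proof.
by move=> H [e1 e2 e3 e4 e5 e6]; split; rewrite ?H // => i lt; rewrite H // ?e5 ?e6.
Qed.

Lemma env_den c S : all (fun a => a \notin writes c) env_ids -> env S -> env (den c S).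
Proof. by move/allP=> H; apply: env_eq => a i /H; apply: den_frame. Qed.

Lemma env_put S x i (a : nat) : x \notin env_ids -> env S -> env (put S x i a).
Proof.
by move=> xe; apply: env_eq => b j be; apply: arr_put; apply: contraNneq xe => <-.
Qed.

Lemma env_pwE S v : env S -> arr S a_pw (rk v) = code [set v].
Proof. by move=> e; rewrite env_pw ?rk_lt // code1. Qed.

Lemma env_deV S v : env S -> arr S a_de (rk v) = 4 ^ n * rk v.
Proof. by move=> e; rewrite env_de // ltn_addr ?rk_lt. Qed.

Lemma env_deC S d : env S -> arr S a_de (crk d) = 4 ^ n * crk d.
Proof. by move=> e; rewrite env_de // ltn_addl ?crk_lt. Qed.

Definition nbr A v : bool := [exists u in A, adj u v].

Definition base_set (ls : seq {set G}) A := (A == set0) || (A \in ls).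

(** [known_nb] also covers the singletons not yet listed, whose rows come straight from the
    adjacency matrix. [known_mk] speaks of all addresses, so that a sum of codes which is not a code
    is found unmarked. *)
Record known (ls : seq {set G}) S : Prop := Known {
  known_uniq : uniq ls;
  known_conn : forall A, A \in ls -> conn A && (A != set0);
  known_cnt : arr S v_cnt 0 = size ls;
  known_L : forall i, arr S a_L i = code (nth set0 ls i);
  known_mk : forall x, arr S a_mk x = (x \in map (@code G) ls);
  known_nb : forall A v, base_set ls A \/ (exists u, A = [set u]) ->
    (0 < arr S a_nb (idx A (rk v))) = nbr A v;
  known_in : forall A v, base_set ls A -> arr S a_in (idx A (rk v)) = (v \in A)
}.

Lemma known_mkE ls S A : known ls S -> arr S a_mk (code A) = (A \in ls).
Proof. by move=> K; rewrite (known_mk K) mem_map //; exact: code_inj. Qed.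

Definition known_ids : seq nat := [:: v_cnt; a_L; a_mk; a_nb; a_in].

Lemma known_eq ls S S' : (forall a i, a \in known_ids -> arr S' a i = arr S a i) ->
  known ls S -> known ls S'.
Proof.
move=> H [k1 k2 k3 k4 k5 k6 k7]; split; rewrite ?H //.
- by move=> i; rewrite H.
- by move=> x; rewrite H.
- by move=> A v hA; rewrite H // k6.
by move=> A v hA; rewrite H // k7.
Qed.

Lemma known_put ls S x i (a : nat) : x \notin known_ids -> known ls S -> known ls (put S x i a).
Proof.
by move=> xe; apply: known_eq => b j be; apply: arr_put; apply: contraNneq xe => <-.
Qed.

Lemma nbrU A v u : nbr (v |: A) u = nbr A u || nbr [set v] u.
Proof.
apply/existsP/orP => [[x /andP[/setU1P[->|xA] xu]]|].
- by right; apply/existsP; exists v; rewrite set11.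
- by left; apply/existsP; exists x; rewrite xA.
by case=> /existsP[x /andP[xA xu]]; exists x; rewrite xu ?inE ?xA ?orbT //; move: xA;
  rewrite inE => ->.
Qed.

Lemma idxE A x : code A + 4 ^ n * x = idx A x. Proof. by []. Qed.

Lemma idx_eq A B x y : (idx A x == idx B y) = (A == B) && (x == y).
Proof.
by apply/eqP/andP => [/idx_inj[-> ->] | [/eqP-> /eqP->]].
Qed.

Lemma known_put_nb ls S Z u (a : nat) : (0 < a) = nbr Z u -> known ls S ->
  known ls (put S a_nb (idx Z (rk u)) a).
Proof.
move=> aE [k1 k2 k3 k4 k5 k6 k7]; split=> // A v hA.
rewrite /put /= /upd2 /=; case: eqP => [/idx_inj[-> /rk_inj->] // | _]; exact: k6.
Qed.

Lemma known_put_in ls S Z x (a : nat) : ~~ base_set ls Z -> known ls S ->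
  known ls (put S a_in (idx Z x) a).
Proof.
move=> nZ [k1 k2 k3 k4 k5 k6 k7]; split=> // A v hA.
rewrite /put /= /upd2 /=; case: eqP => [/idx_inj[AZ _] | _]; last exact: k7.
by rewrite AZ (negPf nZ) in hA.
Qed.

Lemma copy_row_ok S ls A v : let Z := v |: A in
  env S -> known ls S -> base_set ls A -> ~~ base_set ls Z ->
  arr S v_base 0 = code A -> arr S v_v 0 = rk v -> arr S v_z 0 = code Z ->
  let S' := den copy_row S in
  known ls S' /\ forall u, (0 < arr S' a_nb (idx Z (rk u))) = nbr Z u /\
                           arr S' a_in (idx Z (rk u)) = (u \in A).
Proof.
move=> Z eS kS bA nZ bE vE zE; cbn zeta; rewrite [den _ _]/= (env_n eS).
set f := (X in loop X _ _).
pose P i S' := [/\ env S', known ls S',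
  [/\ arr S' v_base 0 = code A, arr S' v_v 0 = rk v & arr S' v_z 0 = code Z] &
  forall u, rk u < i -> (0 < arr S' a_nb (idx Z (rk u))) = nbr Z u /\
                           arr S' a_in (idx Z (rk u)) = (u \in A)].
suff [_ ? _ H] : P n (loop f n S) by split=> // u; apply: H; exact: rk_lt.
apply: loop_ind => // i S' /rkP[u ->] {i} [eS' kS' [bE' vE' zE'] cells].
rewrite /f {f} /= /upd2 /=. rewrite bE' vE' zE' (env_pwE v eS') (env_deV u eS') !idxE.
set S1 := put S' v_j 0 (rk u).
have eS1 : env S1 by apply: env_put.
have kS1 : known ls S1 by apply: known_put.
have nbE : (0 < arr S' a_nb (idx A (rk u)) + arr S' a_nb (idx [set v] (rk u))) = nbr Z u.
  rewrite nbrU addn_gt0 !(known_nb kS') //; first by right; exists v.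
  by left.
have kS2 := known_put_nb nbE kS1.
set S2 := put S1 _ _ _ in kS2 *.
have -> : arr S' a_in (idx A (rk u)) = (u \in A) by rewrite (known_in _ _ bA).
split.
- by apply: env_put => //; apply: env_put.
- exact: known_put_in.
- by [].
move=> x; rewrite ltnS leq_eqVlt => /orP[/eqP/rk_inj -> | lt].
  rewrite /put /= /upd2 /= !eqxx; split=> //; exact: nbE.
rewrite /put /= /upd2 /= !idx_eq !eqxx (ltn_eqF lt) /=.
exact: cells.
Qed.

Lemma add_set_ok S ls A v : env S -> known ls S -> base_set ls A ->
  arr S v_base 0 = code A -> arr S v_v 0 = rk v -> v \notin A -> conn (v |: A) ->
  exists2 t, known (ls ++ t) (den add_set S) & v |: A \in ls ++ t.
Proof.
move=> eS kS bA baseE vE vA cvA.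
have dvA : [disjoint A & [set v]].
  by rewrite disjoint_sym -setI_eq0; apply/eqP/setP => x; rewrite !inE; case: eqP => // ->;
    rewrite (negPf vA).
have zE : code A + code [set v] = code (v |: A) by rewrite codeU // setUC.
set Z := v |: A in zE cvA *.
have := @copy_row_ok (put S v_z 0 (code Z)) ls A v.
have wc : writes copy_row = [:: v_j; a_nb; a_in] by [].
rewrite /add_set; move: copy_row wc => c wc.
rewrite /= /upd2 /= -/Z baseE vE (env_pwE v eS) zE => crow.
rewrite (known_mkE _ kS); case: (boolP (Z \in ls)) => [Z_ls | Z_ls] /=.
  by exists [::]; rewrite cats0 //; apply: known_put.
have n0Z : Z != set0 by apply/set0Pn; exists v; rewrite setU11.
have nZ : ~~ base_set ls Z by rewrite negb_or n0Z.
have [] // := crow; first exact: env_put; first exact: known_put.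
set S1 := den c _ => kS1 cells.
have fr a i : a \notin [:: v_j; a_nb; a_in] -> arr S1 a i = arr (put S v_z 0 (code Z)) a i.
  by move=> aw; apply: den_frame; rewrite wc.
have eS1 : env S1.
  have e0 : env (put S v_z 0 (code Z)) by apply: env_put.
  by apply: env_eq e0 => a i ae; apply: fr; move: ae; rewrite !inE; do !case/orP=> [/eqP->//|];
    move=> /eqP->.
rewrite (fr v_z) // (fr v_v) // [arr (put _ _ _ _) v_z 0]/= [arr (put _ _ _ _) v_v 0]/= /upd2 /=.
rewrite vE (env_deV v eS1) idxE (known_cnt kS1).
exists [:: Z]; last by rewrite mem_cat mem_head orbT.
have baseP (B : {set G}) : base_set (ls ++ [:: Z]) B -> base_set ls B \/ B = Z.
  by rewrite /base_set mem_cat inE orbA => /orP[|/eqP]; auto.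
case: kS1 => k1 k2 k3 k4 k5 k6 k7; split.
- by rewrite cats1 rcons_uniq Z_ls.
- by move=> B; rewrite mem_cat inE => /orP[/k2|/eqP->]; rewrite ?cvA.
- by rewrite size_cat.
- move=> i; rewrite /put /= /upd2 /= k4 nth_cat; case: ltngtP => [lt|gt|->] //.
    by rewrite [nth _ [:: Z] _]nth_default ?nth_default //= ?subn_gt0 // ltnW.
  by rewrite subnn.
- move=> x; rewrite /put /= /upd2 /= map_cat mem_cat inE k5.
  by case: eqP => [->|]; rewrite ?orbT ?orbF.
- move=> B u hB; rewrite /put /= /upd2 /=.
  have [bB | ->] : (base_set ls B \/ exists u, B = [set u]) \/ B = Z.
    by case: hB => [/baseP[]|]; auto.
  - exact: k6.
  - by case: (cells u).
move=> B u /baseP hB; rewrite /put /= /upd2 /= idx_eq.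
case: hB => [bB | ->]; last first.
  case: (cells u) => _ ->; rewrite eqxx /= (inj_eq (@rk_inj G)) in_setU1.
  by case: eqP.
by case: eqP => [BZ|_]; [rewrite BZ (negPf nZ) in bB | apply: k7].
Qed.
Lemma nbr_connU A u : conn A -> nbr A u -> conn (u |: A).
Proof.
move=> cA /existsP[x /andP[xA xu]]; rewrite setUC; apply: connU (conn1 u) _ => //.
by apply/orP; right; apply/separatedPn; exists x, u; rewrite set11.
Qed.

(** The clause on [set0] is for the rounds past the end of the list, which must append nothing. *)
Lemma extend_row_ok S ls i : env S -> known ls S ->
  let A := nth set0 ls i in
  let S' := den extend_row (put S v_i 0 i) in
  exists t, [/\ known (ls ++ t) S', A = set0 -> t = [::] &
    forall v, A \in ls -> v \notin A -> nbr A v -> v |: A \in ls ++ t].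
Proof.
move=> eS kS A; cbn zeta.
have bA : base_set ls A.
  by rewrite /base_set; case: (ltnP i (size ls)) => [/(mem_nth set0)->|/(nth_default set0)];
     rewrite ?orbT // /A => ->; rewrite eqxx.
have := @add_set_ok; have : all (fun a => a \notin writes add_set) env_ids by [].
have : v_base \notin writes add_set by [].
rewrite /extend_row; move: add_set => c wb wc c_ok.
rewrite /= /upd2 /= (env_n eS) (known_L kS) -/A; set f := (X in loop X _ _).
pose P j S' := [/\ env S', arr S' v_base 0 = code A &
  exists t, [/\ known (ls ++ t) S', A = set0 -> t = [::] &
    forall v, rk v < j -> A \in ls -> v \notin A -> nbr A v -> v |: A \in ls ++ t]].
suff [_ _ [t [kt At tA]]] : P n (loop f n (put (put S v_i 0 i) v_base 0 (code A))).
  by exists t; split=> // v; apply: tA; exact: rk_lt.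
apply: loop_ind => [|j S' /rkP[u ->] {j} [eS' bE [t [kt At tA]]]].
  split=> //; first by do 2?[apply: env_put => //].
  by exists [::]; rewrite cats0; split=> //; do 2?[apply: known_put => //].
have bAt : base_set (ls ++ t) A by move: bA; rewrite /base_set mem_cat orbA => ->.
rewrite /f {f} /= bE (env_deV u eS') !idxE (known_in kt _ bAt) (known_nb kt) /=; last by left.
have eS1 : env (put S' v_v 0 (rk u)) by apply: env_put.
have kS1 : known (ls ++ t) (put S' v_v 0 (rk u)) by apply: known_put.
have skip : ~~ (nbr A u && (u \notin A)) -> P (rk u).+1 (put S' v_v 0 (rk u)).
  move=> nu; split=> //; exists t; split=> // v; rewrite ltnS leq_eqVlt.
  case/orP=> [/eqP/rk_inj-> _ uA nA|]; last exact: tA.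
  by rewrite nA uA in nu.
case: (boolP (nbr A u)) => nA; last by apply: skip; rewrite negb_and nA.
case: (boolP (u \in A)) => uA /=; first by apply: skip; rewrite uA andbF.
have A0 : A != set0 by apply: contraTneq nA => ->; apply/existsPn => x; rewrite inE.
have A_ls : A \in ls by move: bA; rewrite /base_set (negPf A0).
have cA : conn A by have /andP[] := known_conn kS A_ls.
have [t2 kt2 uA2] := c_ok _ _ _ _ eS1 kS1 bAt bE erefl uA (nbr_connU cA nA).
split.
- exact: env_den.
- by rewrite den_frame.
exists (t ++ t2); rewrite catA; split=> // [A00|v]; first by rewrite A00 eqxx in A0.
rewrite ltnS leq_eqVlt => /orP[/eqP/rk_inj-> // | lt Als vA vn].
by rewrite mem_cat tA.
Qed.

(** The list has no repetitions, hence at most [N] members, and [N] rounds scan all of them.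
    Completeness follows by induction on the size: a non-cut vertex is removed, and putting it back
    is one of the extensions tried. *)
Lemma enumerate_ok S :
  #|[set A : {set G} | conn A && (A != set0)]| <= N ->
  env S -> known [::] S ->
  exists2 ls, known ls (den enumerate S) & forall A, conn A -> A != set0 -> A \in ls.
Proof.
move=> leN eS kS.
rewrite -[den _ _]/(den (For v_i v_N extend_row) (den add_singletons S)).
set S1 := den add_singletons S.
have [eS1 [ls1 k1 sing1]] : env S1 /\ exists2 ls, known ls S1 & forall v, [set v] \in ls.
  rewrite /S1 /add_singletons; have := @add_set_ok;
    have : all (fun a => a \notin writes add_set) env_ids by [].
  move: add_set => c wc c_ok; rewrite /= (env_n eS).
  set f := (X in loop X _ _).
  pose P i S' := env S' /\ exists2 ls, known ls S' & forall v, rk v < i -> [set v] \in ls.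
  suff [e1 [ls kls H]] : P n (loop f n S).
    by split=> //; exists ls => // v; apply: H; exact: rk_lt.
  apply: loop_ind => [|i S' /rkP[u ->] {i} [eS' [ls kls H]]]; first by split=> //; exists [::].
  have e2 : env (put (put S' v_v 0 (rk u)) v_base 0 0) by do 2?[apply: env_put => //].
  have k2 : known ls (put (put S' v_v 0 (rk u)) v_base 0 0) by do 2?[apply: known_put => //].
  have b2 : base_set ls set0 by rewrite /base_set eqxx.
  have [||||t kt] := c_ok _ _ _ u e2 k2 b2; rewrite ?code0 ?inE ?setU0 //; first exact: conn1.
  move=> ut; split; first exact: env_den.
  exists (ls ++ t) => // v; rewrite ltnS leq_eqVlt => /orP[/eqP/rk_inj-> // | /H].
  by rewrite mem_cat => ->.
clearbody S1; clear eS kS S.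
have wb : all (fun a => a \notin writes extend_row) env_ids by [].
have := @extend_row_ok; move: extend_row wb => body wb body_ok.
rewrite /= (env_N eS1); set f := (X in loop X _ _).
pose P i S' := env S' /\ exists ls, [/\ known ls S', forall v, [set v] \in ls &
  forall A v, A \in take i ls -> v \notin A -> nbr A v -> v |: A \in ls].
suff [_ [ls [kls sing ext]]] : P N (loop f N S1).
  have szN : size ls <= N.
    rewrite -(card_uniqP (known_uniq kls)); apply: leq_trans leN; apply: subset_leq_card.
    by apply/subsetP => A /(known_conn kls); rewrite inE.
  rewrite take_oversize // in ext.
  exists ls => // A; elim: {A}#|A| {-2}A (leqnn #|A|) => [|k IHk] A leA cA A0.
    by move: leA; rewrite leqn0 cards_eq0 (negPf A0).
  have [A1 | A1] := leqP #|A| 1.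
    have [v vA] := set0Pn _ A0; suff -> : A = [set v] by [].
    by apply/eqP; rewrite eq_sym eqEcard sub1set vA cards1.
  have [v vA cAv] := conn_noncut cA A1.
  have cardAv : #|A :\ v| = #|A|.-1 by rewrite [in RHS](cardsD1 v) vA.
  have Av0 : A :\ v != set0 by rewrite -cards_eq0 cardAv -lt0n -subn1 subn_gt0.
  have Avls : A :\ v \in ls by apply: IHk; rewrite // cardAv -ltnS prednK // ltnW.
  rewrite -(setD1K vA); apply: ext; rewrite ?setD11 //.
  have neA : A :\ v != A by apply: contraTneq vA => <-; rewrite setD11.
  have [x [y [xA /setDP[yA]]]] := conn_edge cA (subD1set A v) Av0 neA.
  rewrite !inE yA andbT negbK => /eqP-> xv.
  by apply/existsP; exists x; rewrite xA.
apply: loop_ind => [|i S' lt [eS' [ls [kls sing ext]]]].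
  by split=> //; exists ls1; split=> // A v; rewrite take0.
split; first by apply: env_den => //; apply: env_put.
have [t [kt At tA]] := body_ok S' ls i eS' kls.
exists (ls ++ t); split=> // [v | A v]; first by rewrite mem_cat sing.
case: (ltnP i (size ls)) => lti.
  rewrite takel_cat // (take_nth set0) // mem_rcons inE => /orP[/eqP-> | Als vA vn].
    by apply: tA; apply: mem_nth.
  by rewrite mem_cat (ext A).
rewrite At ?nth_default // cats0 take_oversize; last exact: leqW.
by rewrite -{1}(take_oversize lti); apply: ext.
Qed.
Lemma known_size ls S : known ls S ->
  size ls <= #|[set A : {set G} | conn A && (A != set0)]|.
Proof.
move=> kS; rewrite -(card_uniqP (known_uniq kS)); apply: subset_leq_card.
by apply/subsetP => A /(known_conn kS); rewrite inE.
Qed.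

(** * The table of values *)

Definition tv S A d : nat := arr S a_T (idx A (crk d)).

Definition attains S A d k : bool := 0 < tv S A d <= k.+1.

(** Also keeps the entries of the empty set at 0, which makes the positions past the end of the list
    harmless. *)
Definition sound S : Prop :=
  forall A d k, tv S A d = k.+1 -> A != set0 /\ der w A d k.

Definition better S S' : Prop :=
  forall x, 0 < arr S a_T x -> 0 < arr S' a_T x <= arr S a_T x.

Lemma better_refl S : better S S.
Proof. by move=> x ->; rewrite leqnn. Qed.

Arguments better_refl : clear implicits.

Lemma better_trans S1 S2 S3 : better S1 S2 -> better S2 S3 -> better S1 S3.
Proof.
by move=> b12 b23 x /b12/andP[x2 le2]; have /andP[-> le3] := b23 x x2; apply: leq_trans le2.
Qed.

Arguments better_trans {S1 S2 S3} _ _.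

Lemma better_put S S' x i (a : nat) : x != a_T -> better S S' -> better S (put S' x i a).
Proof. by move=> xT b y /b; rewrite arr_put // eq_sym. Qed.

Arguments better_put {S S' x} i a _ _.

Lemma better_after S S' x i (a : nat) : x != a_T -> better (put S x i a) S' -> better S S'.
Proof. by move=> xT; apply: better_trans (better_put i a xT (better_refl S)). Qed.

Arguments better_after {S S' x i a} _ _.

Lemma better_attains S S' A d k : better S S' -> attains S A d k -> attains S' A d k.
Proof.
by move=> b /andP[/b/andP[p le1] le2]; rewrite /attains p; apply: leq_trans le2.
Qed.

Lemma attains_leq S A d k k' : k <= k' -> attains S A d k -> attains S A d k'.
Proof. by move=> kk /andP[p le]; rewrite /attains p; apply: leq_trans le _. Qed.

Lemma relax_ok key val S A d k : ev key S = idx A (crk d) -> ev val S = k.+1 ->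
  A != set0 -> der w A d k -> sound S ->
  let S' := den (relax key val) S in
  [/\ sound S', better S S' & attains S' A d k].
Proof.
move=> keyE valE A0 D sS; rewrite /= keyE valE /attains /tv; case: ifPn => c.
  rewrite /= /upd2 /= eqxx leqnn; split=> //.
    move=> B e j; rewrite /tv /= /upd2 /=; case: eqP => [/idx_inj[-> /crk_inj->] [<-] // | _].
    exact: sS.
  move=> x px; rewrite /= /upd2 /=; case: eqP => [E|_]; last by rewrite px leqnn.
  move: c px; rewrite E; move: (arr S _ _) => t; lia.
split=> //; first exact: better_refl.
by move: c; move: (arr S _ _) => t; lia.
Qed.

Section Relaxation.
Variables (ls : seq {set G}) (S0 : state).

(** [S0] is the state in which a pass begins. The table is updated in place, so a value read later
    may be smaller than in [S0]; it suffices that it is never larger. *)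
Definition good S : Prop := [/\ env S, known ls S, sound S & better S0 S].

Lemma good_put S x i (a : nat) : x \notin env_ids ++ known_ids -> x != a_T ->
  good S -> good (put S x i a).
Proof.
rewrite mem_cat negb_or => /andP[xe xk] xT [e k s b]; split.
- exact: env_put.
- exact: known_put.
- by move=> A d j; rewrite /tv arr_put ?(eq_sym a_T) //; apply: s.
- exact: better_put.
Qed.

Lemma good_den c S : all (fun a => a \notin writes c) (env_ids ++ known_ids) ->
  good S -> sound (den c S) -> better S (den c S) -> good (den c S).
Proof.
move=> wc [e k s b] s' b'; split=> //; last exact: better_trans b'.
- by apply: env_den => //; move: wc; rewrite all_cat => /andP[].
- apply: known_eq k => a i ak; apply: den_frame.
  by apply: (allP wc); rewrite mem_cat ak orbT.
Qed.

(** What round [i] achieves is not undone by later rounds, because [Q i] is stable under improvement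
    of the table. *)
Lemma loop_better (I : state -> Prop) (Q : nat -> state -> Prop) f k S :
  (forall i S1 S2, better S1 S2 -> Q i S1 -> Q i S2) ->
  (forall i S', i < k -> I S' -> [/\ I (f i S'), better S' (f i S') & Q i (f i S')]) ->
  I S -> [/\ I (loop f k S), better S (loop f k S) & forall i, i < k -> Q i (loop f k S)].
Proof.
move=> Qb step; elim: k step => [|k IHk] step IS.
  by split=> //; apply: better_refl.
have [I1 b1 Q1] := IHk (fun i S' lt => step i S' (ltnW lt)) IS.
have [I2 b2 Q2] := step k _ (ltnSn k) I1; split=> //; first exact: better_trans b2.
by move=> i; rewrite ltnS leq_eqVlt => /orP[/eqP-> // | /Q1]; apply: Qb.
Qed.

Notation set_of i := (nth set0 ls i).

Definition joined i j d S : Prop :=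
  [disjoint set_of i & set_of j] -> set_of i :|: set_of j \in ls ->
  forall k1 k2, attains S0 (set_of i) d k1 -> attains S0 (set_of j) d k2 ->
  attains S (set_of i :|: set_of j) d (k1 + k2).

Lemma joined_better i j d S1 S2 : better S1 S2 -> joined i j d S1 -> joined i j d S2.
Proof.
by move=> b J dij Uls k1 k2 h1 h2; apply: (better_attains b); apply: J.
Qed.

Lemma T_atE S l x i d : good S -> arr S l 0 = i -> arr S x 0 = crk d ->
  ev (T_at l x) S = idx (set_of i) (crk d).
Proof.
by case=> e k _ _ lE xE; rewrite /= lE xE (known_L k) (env_deC d e).
Qed.

Lemma join_cell_ok S i j d : good S ->
  arr S v_i 0 = i -> arr S v_j 0 = j -> arr S v_d 0 = crk d ->
  [disjoint set_of i & set_of j] -> set_of i :|: set_of j \in ls ->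
  let S' := den join_cell S in [/\ good S', better S S' & joined i j d S'].
Proof.
move=> gS iE jE dE dij Uls; cbn zeta; have [eS kS sS bS] := gS.
have Ei := T_atE gS iE dE; have Ej := T_atE gS jE dE.
have keyE : ev (EGet a_L (Var v_i) +: T_at v_j v_d) S = idx (set_of i :|: set_of j) (crk d).
  by rewrite -[ev _ _]/(arr S a_L (arr S v_i 0) + ev (T_at v_j v_d) S) Ej iE (known_L kS) /idx
    addnA codeU.
have wc : all (fun a => a \notin writes join_cell) (env_ids ++ known_ids) by [].
have gd := good_den wc gS.
suff [s' b' J] : [/\ sound (den join_cell S), better S (den join_cell S) & joined i j d (den
  join_cell S)].
  by split=> //; apply: gd.
have {Ei}Ei : ev (EGet a_T (T_at v_i v_d)) S = tv S (set_of i) d by rewrite /tv -Ei.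
have {Ej}Ej : ev (EGet a_T (T_at v_j v_d)) S = tv S (set_of j) d by rewrite /tv -Ej.
have skip : ~~ ((0 < tv S (set_of i) d) && (0 < tv S (set_of j) d)) -> joined i j d S.
  move=> no _ _ k1 k2 /(better_attains bS)/andP[p1 _] /(better_attains bS)/andP[p2 _].
  by rewrite p1 p2 in no.
rewrite /join_cell; set key := _ +: T_at v_j v_d in keyE *.
set val := _ -: _; have valE : ev val S = tv S (set_of i) d + tv S (set_of j) d - 1.
  by rewrite -Ei -Ej.
have rel := relax_ok keyE; move: {rel}(rel val) valE; move: (relax key val) => c rel valE.
rewrite -[den _ S]/(if 0 < ev (EGet a_T (T_at v_i v_d)) S then
  if 0 < ev (EGet a_T (T_at v_j v_d)) S then den c S else S else S) Ei Ej.
case Ti: (tv S (set_of i) d) => [|k1] /=.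
  by split=> //; [exact: better_refl | apply: skip; rewrite Ti].
case Tj: (tv S (set_of j) d) => [|k2] /=.
  by split=> //; [exact: better_refl | apply: skip; rewrite Tj andbF].
have [n0 D1] := sS _ _ _ Ti; have [_ D2] := sS _ _ _ Tj.
have [||s' b' h'] := rel (k1 + k2) _ _ (DerU dij D1 D2) sS.
- by rewrite valE Ti Tj; lia.
- by rewrite setU_eq0 negb_and n0.
split=> // _ _ h1 h2 H1 H2; apply: attains_leq h'.
move: (better_attains bS H1) (better_attains bS H2); rewrite /attains Ti Tj; lia.
Qed.

Lemma join_pair_ok S i j : good S -> arr S v_i 0 = i -> arr S v_j 0 = j ->
  let S' := den join_pair S in [/\ good S', better S S' & forall d, joined i j d S'].
Proof.
move=> gS iE jE; cbn zeta; have [eS kS sS bS] := gS.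
have := join_cell_ok; have : all (fun a => a \notin writes join_cell) [:: v_i; v_j] by [].
rewrite /join_pair; move: join_cell => c wc c_ok.
rewrite /= iE jE !(known_L kS) (known_mk kS) (env_m eS).
set f := (X in loop X _ _).
case: (boolP (_ \in _)) => [/mapP[Z Zls /codeD_inv[dij UE]] | nin] /=; last first.
  split=> //; first exact: better_refl.
  by move=> d dij Uls; case/negP: nin; rewrite codeU //; apply: map_f.
rewrite -UE in Zls.
pose I S' := [/\ good S', arr S' v_i 0 = i & arr S' v_j 0 = j].
pose Q k S' := forall d, k = crk d -> joined i j d S'.
have [|||[g' _ _] b' Q'] := @loop_better I Q f m S.
- by move=> k S1 S2 b Q1 d kd; apply: joined_better b (Q1 d kd).
- move=> k S' /crkP[d ->] {k} [gS' iE' jE'].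
  have g1 : good (put S' v_d 0 (crk d)) by apply: good_put.
  have [] // := c_ok _ i j d g1 => g2 b2 J.
  split.
  + by case/and3P: wc => w1 w2 _; split=> //; rewrite den_frame.
  + by apply: better_after b2.
  + by move=> e /crk_inj <-.
- by [].
by split=> // d; apply: Q' (crk_lt d) _ erefl.
Qed.

Lemma join_pairs_ok S : good S ->
  let S' := den join_pairs S in
  [/\ good S', better S S' & forall i j d, i < N -> j < N -> joined i j d S'].
Proof.
move=> gS; cbn zeta.
have := join_pair_ok; have : all (fun a => a \notin writes join_pair) [:: v_i] by [].
rewrite /join_pairs; move: join_pair => c wc c_ok.
have [eS kS sS bS] := gS; rewrite /= (env_N eS).
set f := (X in loop X _ _).
have [|||g' b' Q'] := @loop_better good (fun i S' => forall j d, j < N -> joined i j d S') f N S.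
- by move=> i S1 S2 b Q1 j d lt; apply: joined_better b (Q1 j d lt).
- move=> i S' lti gS'; have [eS' _ _ _] := gS'; rewrite /f /upd2 /= (env_N eS').
  have g1 : good (put S' v_i 0 i) by apply: good_put.
  have [|||[g2 _] b2 Q2] := @loop_better (fun S1 => good S1 /\ arr S1 v_i 0 = i)
      (fun j S1 => forall d, joined i j d S1) (fun j S1 =>
        den c (put S1 v_j 0 j)) N (put S' v_i 0 i).
  + by move=> j S1 S2 b Q1 d; apply: joined_better b (Q1 d).
  + move=> j S1 ltj [gS1 iE1].
    have g2 : good (put S1 v_j 0 j) by apply: good_put.
    have [] // := c_ok _ i j g2 => g3 b3 J.
    split=> //.
    by split=> //; rewrite den_frame //; case/andP: wc.
  + by [].
  split=> //.
  by move=> j d ltj; apply: Q2.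
- by [].
by split=> // i j d lti ltj; apply: Q'.
Qed.

Lemma recolour_cell_ok S i d : good S -> arr S v_i 0 = i -> arr S v_d 0 = crk d ->
  let S' := den recolour_cell S in
  [/\ good S', better S S' & forall k e, attains S0 (set_of i) d k -> attains S' (set_of i) e
    k.+1].
Proof.
move=> gS iE dE; cbn zeta; have [eS kS sS bS] := gS.
have Ei S1 : good S1 -> arr S1 v_i 0 = i -> arr S1 v_d 0 = crk d ->
  ev (EGet a_T (T_at v_i v_d)) S1 = tv S1 (set_of i) d by move=> g1 i1 d1;
    rewrite /tv -(T_atE g1 i1 d1).
rewrite /recolour_cell; set c := relax _ _.
rewrite -[den _ S]/(if 0 < ev (EGet a_T (T_at v_i v_d)) S then
  loop (fun j S1 => den c (put S1 v_e 0 j)) (arr S v_m 0) S else S) Ei // (env_m eS).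
case: ifPn => [pT | nT]; last first.
  split=> //; first exact: better_refl.
  by move=> k e /(better_attains bS)/andP[p _]; rewrite p in nT.
(* The source entry is read again in each round and may itself have been relaxed; [better S S']
   keeps it positive. *)
pose I S' := [/\ good S', arr S' v_i 0 = i, arr S' v_d 0 = crk d & better S S'].
pose Q k S' := forall e, k = crk e -> forall k, attains S0 (set_of i) d k -> attains S' (set_of
  i) e k.+1.
have [|||[g' _ _ _] b' Q'] := @loop_better I Q (fun j S1 => den c (put S1 v_e 0 j)) m S.
- by move=> j S1 S2 b Q1 e je k /(Q1 e je); apply: better_attains.
- move=> j S' /crkP[e ->] {j} [gS' iE' dE' bS'].
  set S1 := put S' v_e 0 (crk e).
  have g1 : good S1 by apply: good_put.
  have [_ kS1 sS1 bS1] := g1.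
  have iE1 : arr S1 v_i 0 = i by [].
  have dE1 : arr S1 v_d 0 = crk d by [].
  have eE1 : arr S1 v_e 0 = crk e by [].
  have keyE := T_atE g1 iE1 eE1.
  have bSS1 : better S S1 by apply: better_put.
  have : 0 < tv S1 (set_of i) d by have /andP[] := bSS1 _ pT.
  case Ti : (tv S1 (set_of i) d) => [//|k1] _.
  have valE : ev (EGet a_T (T_at v_i v_d) +: ENum 1) S1 = k1.+2.
    by rewrite -[ev _ _]/(ev (EGet a_T (T_at v_i v_d)) S1 + 1) Ei // Ti addn1.
  have [n0 D] := sS1 _ _ _ Ti.
  have cA : conn (set_of i).
    case: (ltnP i (size ls)) => [/(mem_nth set0)/(known_conn kS1)/andP[]//|].
    by move=> lei; rewrite nth_default // eqxx in n0.
  have [s2 b2 h2] := relax_ok keyE valE n0 (DerM e cA n0 D) sS1.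
  have g2 : good (den c S1) by apply: good_den.
  split=> //.
  + by split=> //; [rewrite den_frame | rewrite den_frame | apply: better_trans b2].
  move=> e' /crk_inj <- k /(better_attains bS1); rewrite /attains Ti /= ltnS => le.
  by apply: attains_leq h2; rewrite ltnS.
- by split=> //; exact: better_refl.
by split=> // k e; apply: Q' (crk_lt e) _ erefl _.
Qed.

Lemma recolour_ok S : good S ->
  let S' := den recolour S in
  [/\ good S', better S S' &
    forall i d e k, i < N -> attains S0 (set_of i) d k -> attains S' (set_of i) e k.+1].
Proof.
move=> gS; cbn zeta.
have := recolour_cell_ok; have : all (fun a => a \notin writes recolour_cell) [:: v_i] by [].
rewrite /recolour; move: recolour_cell => c wc c_ok.
have [eS kS sS bS] := gS; rewrite /= (env_N eS).
set f := (X in loop X _ _).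
pose Q i S' := forall d e k, attains S0 (set_of i) d k -> attains S' (set_of i) e k.+1.
have Qb i S1 S2 : better S1 S2 -> Q i S1 -> Q i S2.
  by move=> b Q1 d e k /(Q1 d e k); apply: better_attains.
have [|||g' b' Q'] := @loop_better good Q f N S.
- exact: Qb.
- move=> i S' lti gS'; have [eS' _ _ _] := gS'; rewrite /f /upd2 /= (env_m eS').
  have g1 : good (put S' v_i 0 i) by apply: good_put.
  pose R j S1 := forall d, j = crk d -> forall e k, attains S0 (set_of i) d k -> attains S1
    (set_of i) e k.+1.
  have [|||[g2 _] b2 Q2] := @loop_better (fun S1 => good S1 /\ arr S1 v_i 0 = i)
      R (fun j S1 => den c (put S1 v_d 0 j)) m (put S' v_i 0 i).
  + by move=> j S1 S2 b Q1 d jd e k /(Q1 d jd e k); apply: better_attains.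
  + move=> j S1 /crkP[d ->] {j} [gS1 iE1].
    have g2 : good (put S1 v_d 0 (crk d)) by apply: good_put.
    have [] // := c_ok _ i d g2 => g3 b3 J.
    split=> //; last by move=> d' /crk_inj <- e k; apply: J.
    by split=> //; rewrite den_frame //; case/andP: wc.
  + by [].
  split=> //.
  by move=> d e k; apply: Q2 (crk_lt d) _ erefl _ _.
- by [].
by split=> // i d e k lti; apply: Q'.
Qed.
End Relaxation.
Lemma optimise_ok S ls : size ls <= N -> env S -> known ls S -> sound S ->
  (forall A, conn A -> A != set0 -> A \in ls) -> (forall v, attains S [set v] (w v) 0) ->
  let S' := den optimise S in
  [/\ env S', known ls S', sound S' &
    forall A d k, A \in ls -> der w A d k -> attains S' A d k].
Proof.
move=> szls eS kS sS complete base; cbn zeta.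
have := join_pairs_ok; have := recolour_ok; rewrite /optimise.
move: join_pairs recolour => c1 c2 c2_ok c1_ok; rewrite /= (env_n eS).
set f := (X in loop X _ _).
pose P r S' := [/\ env S', known ls S', sound S' /\ (forall v, attains S' [set v] (w v) 0) &
  forall A d k, A \in ls -> #|A| <= r -> der w A d k -> attains S' A d k].
suff [e1 k1 [s1 _] H] : P n (loop f n S) by split=> // A d k Als; apply: H; rewrite // max_card.
apply: loop_ind => [|r S' _ [eS' kS' [sS' base'] H]].
  split=> // A d k Als; rewrite leqn0 cards_eq0 => A0.
  by have := known_conn kS Als; rewrite A0 andbF.
rewrite /f; set S1 := put S' v_r 0 r.
have g1 : good ls S1 S1.
  by split; [exact: env_put | exact: known_put | exact: sS' | exact: better_refl].
have [g2 b12 J] := c1_ok ls S1 S1 g1; set S2 := den c1 S1 in g2 b12 J *.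
have [e2 k2 s2 _] := g2.
have g2' : good ls S2 S2 by split=> //; exact: better_refl.
have [[e3 k3 s3 _] b23 R] := c2_ok ls S2 S2 g2'; set S3 := den c2 S2 in e3 k3 s3 b23 R *.
have base2 v : attains S2 [set v] (w v) 0 by apply: (better_attains b12); apply: base'.
have idxN A : A \in ls -> index A ls < N by move=> Als; apply: leq_trans szls; rewrite index_mem.
split=> //; first by split=> // v; apply: (better_attains b23).
move=> A d k Als leA D; have /andP[cA A0] := known_conn kS Als.
have R' e j : attains S2 A e j -> attains S3 A d j.+1.
  by move=> h; have := R (index A ls) e d j (idxN A Als); rewrite nth_index //; apply.
case: (leqP #|A| 1) => [A1 | A1].
  have [v vA] := set0Pn _ A0; have EA : A = [set v].
    by apply/eqP; rewrite eq_sym eqEcard sub1set vA cards1.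
  rewrite EA in D R' *; case/orP: (der1_inv D) => [/eqP <- | k_gt0].
    by apply: attains_leq (better_attains b23 (base2 v)).
  by apply: attains_leq k_gt0 (R' _ _ (base2 v)).
have [B [B' [e [i [j [EA dBB [cB cB' B0 B0'] [DB DB'] le]]]]]] := der_conn_split D cA A1.
have cardA : #|A| = #|B| + #|B'| by rewrite -EA cardsU (disjoint_setI0 dBB) cards0 subn0.
have Bls := complete B cB B0; have B'ls := complete B' cB' B0'.
(* Both parts are nonempty, so each has fewer vertices than [A] and was settled by the earlier
   rounds. *)
have h : attains S2 A e (i + j).
  have := J (index B ls) (index B' ls) e (idxN _ Bls) (idxN _ B'ls).
  rewrite /joined !nth_index // EA; apply=> //.
    by apply: H => //; rewrite -ltnS; apply: leq_trans leA;
      rewrite cardA -addn1 leq_add2l card_gt0.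
  by apply: H => //; rewrite -ltnS; apply: leq_trans leA; rewrite cardA -add1n leq_add2r card_gt0.
(* Either the join already has colour [d], or the strict inequality pays for one recolouring. *)
case/orP: le => [/andP[le /eqP <-] | lt].
  exact: attains_leq le (better_attains b23 h).
exact: attains_leq lt (R' _ _ h).
Qed.

Definition saturated A : bool := separated A (~: A).

Lemma saturatedP A : reflect (forall u, u \notin A -> nbr A u = false) (saturated A).
Proof.
apply: (iffP (separatedP _ _)) => [H u uA | H x u xA].
  by apply/existsP => -[x /andP[xA xu]]; have := H x u xA; rewrite inE uA xu => /(_ isT).
by rewrite inE => /H /existsP nx; apply/negP => xu; case: nx; exists x; rewrite xA.
Qed.

Lemma saturation_test_ok S ls i : env S -> known ls S -> arr S v_i 0 = i ->
  arr (den saturation_test S) v_cl 0 = saturated (nth set0 ls i).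
Proof.
move=> eS kS iE; set A := nth set0 ls i.
have bA : base_set ls A.
  by rewrite /base_set; case: (ltnP i (size ls)) => [/(mem_nth set0)->|/(nth_default set0)];
     rewrite ?orbT // /A => ->; rewrite eqxx.
rewrite /= /upd2 /= (env_n eS); set f := (X in loop X _ _).
pose P j S' := [/\ env S', known ls S', arr S' v_i 0 = i &
  arr S' v_cl 0 = [forall u, (rk u < j) && (u \notin A) ==> ~~ nbr A u]].
have [_ _ _ ->] : P n (loop f n (put S v_cl 0 1)).
  apply: loop_ind => [|j S' /rkP[u ->] {j} [eS' kS' iE' clE]].
    split=> //; [exact: env_put | exact: known_put |].
    by rewrite (_ : [forall u, _] = true) //; apply/forallP.
  have e1 : env (put S' v_v 0 (rk u)) by apply: env_put.
  have k1 : known ls (put S' v_v 0 (rk u)) by apply: known_put.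
  rewrite /f {f} /= /upd2 /= iE' (known_L kS') -/A (env_deV u eS') !idxE.
  rewrite (known_in kS' _ bA) (known_nb kS') /=; last by left.
  have allE (b : bool) : nbr A u && (u \notin A) = b ->
    [forall x, (rk x < (rk u).+1) && (x \notin A) ==> ~~ nbr A x] =
    ~~ b && [forall x, (rk x < rk u) && (x \notin A) ==> ~~ nbr A x].
    move=> <-; apply/forallP/andP => [H | [nu /forallP H] x].
      split; first by move: (H u); rewrite ltnSn; case: (u \in A); case: (nbr A u).
      apply/forallP => x; apply/implyP => /andP[lt xA].
      by move/implyP: (H x); apply; rewrite xA ltnW.
    apply/implyP; rewrite ltnS leq_eqVlt => /andP[/orP[/eqP/rk_inj->|lt] xA].
      by move: nu; rewrite xA andbT.
    by move/implyP: (H x); apply; rewrite lt.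
  case nA : (nbr A u) allE => allE; last first.
    by split=> //; rewrite (allE false).
  case uA : (u \in A) allE => allE /=.
    by split=> //; rewrite (allE false).
  split=> //; [exact: env_put | exact: known_put |].
  by rewrite (allE true).
congr nat_of_bool; apply/forallP/saturatedP => H u.
  by move=> uA; apply/negbTE; move: (H u); rewrite rk_lt uA.
by apply/implyP => /andP[_ /H ->].
Qed.

Lemma collect_row_ok S ls i : let c := saturation_test ;; When (Var v_cl) (For v_d v_m (
    Put a_ans (Var v_d) (EGet a_ans (Var v_d) +: (EGet a_T (T_at v_i v_d) -: ENum 1)))) in
  env S -> known ls S -> arr S v_i 0 = i -> forall d,
  arr (den c S) a_ans (crk d) = arr S a_ans (crk d) +
    saturated (nth set0 ls i) * (tv S (nth set0 ls i) d - 1).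
Proof.
move=> c eS kS iE d; rewrite /c {c}; have := saturation_test_ok eS kS iE.
have fr a x : a \notin [:: v_cl; v_v] -> arr (den saturation_test S) a x = arr S a x.
  by move=> aw; apply: den_frame; move: aw; rewrite !inE; do !case: eqP.
have e1 : env (den saturation_test S) by apply: env_den.
move: saturation_test fr e1 => c fr e1 clE; rewrite /= clE.
set S1 := den c S in fr e1 *; case: (saturated _) => /=; last by rewrite mul0n addn0 fr.
rewrite (env_m e1) mul1n -(fr a_ans) //; set A := nth set0 ls i.
set f := (X in loop X _ _).
pose P j S' := [/\ forall a x, a \notin [:: v_d; a_ans] -> arr S' a x = arr S1 a x &
  forall d, arr S' a_ans (crk d) = arr S1 a_ans (crk d) + (crk d < j) * (tv S A d - 1)].
have [_ ->] : P m (loop f m S1); last by rewrite crk_lt mul1n.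
apply: loop_ind => [|j S' /crkP[e ->] {j} [fr' ansE]].
  by split=> // e; rewrite mul0n addn0.
rewrite /f {f} /= /upd2 /= (fr' a_T) // (fr' a_L) // (fr' v_i) // (fr' a_de) //.
rewrite (env_deC e e1) (fr a_T) // (fr a_L) // (fr v_i) // iE (known_L kS) idxE.
split=> [a x | e']; first by rewrite !inE negb_or => /andP[/negPf ad /negPf aa];
  rewrite /= /upd2 ad aa /= fr' // !inE ad aa.
rewrite /= /upd2 /= (inj_eq crk_inj) ltnS; case: eqP => [-> | ne].
  by rewrite leqnn ansE ltnn mul0n addn0 mul1n.
have -> : (crk e' <= crk e) = (crk e' < crk e) by rewrite leq_eqVlt (inj_eq crk_inj); case: eqP.
exact: ansE.
Qed.

Lemma collect_ok S ls : size ls <= N -> env S -> known ls S -> sound S ->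
  (forall A, conn A -> A != set0 -> A \in ls) ->
  (forall A d k, A \in ls -> der w A d k -> attains S A d k) ->
  (forall d, arr S a_ans (crk d) = 0) ->
  forall d, arr (den collect S) a_ans (crk d) = min_moves_to w d.
Proof.
move=> szls eS kS sS complete opt ans0 d.
have -> : arr (den collect S) a_ans (crk d) = \sum_(A <- ls | saturated A) (tv S A d - 1).
  have := collect_row_ok; rewrite /collect; cbn zeta.
  set c := _ ;; _; have wT : a_T \notin writes c by [].
  have we : all (fun a => a \notin writes c) env_ids by [].
  have : all (fun a => a \notin writes c) known_ids by [].
  move: c wT we => c wT we wk c_ok; rewrite /= (env_N eS); set f := (X in loop X _ _).
  pose P i S' := [/\ env S', known ls S', forall x, arr S' a_T x = arr S a_T x &
    arr S' a_ans (crk d) = \sum_(A <- take i ls | saturated A) (tv S A d - 1)].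
  have [_ _ _ ->] : P N (loop f N S); last by rewrite take_oversize.
  apply: loop_ind => [|i S' lti [eS' kS' TE ansE]].
    by split=> //; rewrite take0 big_nil.
  have e1 : env (put S' v_i 0 i) by apply: env_put.
  have k1 : known ls (put S' v_i 0 i) by apply: known_put.
  rewrite /f; split.
  - exact: env_den e1.
  - by apply: known_eq k1 => a x ak; apply: den_frame; apply: (allP wk).
  - by move=> x; rewrite den_frame ?arr_put ?TE.
  rewrite (c_ok _ ls i) // arr_put // ansE /tv arr_put // TE.
  have [lt | ge] := ltnP i (size ls).
    rewrite (take_nth set0) // -cats1 big_cat /= big_cons big_nil.
    by case: ifP => _; rewrite ?mul1n ?mul0n ?addn0.
  rewrite !take_oversize //; last exact: leqW.
  rewrite nth_default // -/(tv S set0 d); suff -> : tv S set0 d = 0 by rewrite muln0 addn0.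
  case E: (tv S set0 d) => [//|k].
  by case: (sS set0 d k E); rewrite eqxx.
rewrite -big_filter; set cs := filter _ ls.
have csP A : A \in cs -> [/\ saturated A, conn A & A \in ls].
  by rewrite mem_filter => /andP[cA Als]; have /andP[] := known_conn kS Als.
(* Each of two components lies inside the other or misses it, so distinct ones are disjoint. *)
have disj A B : A \in cs -> B \in cs -> A != B -> [disjoint A & B].
  move=> /csP[clA cA _] /csP[clB cB _] neq.
  have sepT (Z : {set G}) : saturated Z -> separated Z (setT :\: Z) by rewrite setTD.
  case: (conn_sub cA (subsetT A) (subsetT B) (sepT _ clB)) => // sAB.
  case: (conn_sub cB (subsetT B) (subsetT A) (sepT _ clA)) => sBA; last by rewrite disjoint_sym.
  by rewrite eqEsubset sAB sBA in neq.
have pw : pairwise (fun A B : {set G} => [disjoint A & B]) cs.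
  have : uniq cs by rewrite filter_uniq // (known_uniq kS).
  elim: cs {csP} disj => //= A s IHs disj /andP[As us].
  rewrite IHs // => [|B B' Bs B's]; last by apply: disj; rewrite inE ?Bs ?B's orbT.
  rewrite andbT; apply/allP => B Bs; apply: disj; rewrite ?mem_head ?inE ?Bs ?orbT //.
  by apply: contraNneq As => ->.
have cover : setT = \bigcup_(A <- cs) A.
  apply/esym/eqP; rewrite -subTset; apply/subsetP => v _.
  have [Z [cZ vZ _ sepZ]] := conn_comp (in_setT v).
  have Zcs : Z \in cs.
    rewrite mem_filter complete // ?andbT; first by rewrite /saturated -setTD.
    by apply/set0Pn; exists v.
  by rewrite (big_rem Z) //= inE vZ.
have DT := min_moves_to_der w d.
(* Cutting an optimal derivation of the whole graph along [A] shows that the entry is not 0, so that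
   the subtraction of 1 is exact. *)
have Dval A : A \in cs -> der w A d (tv S A d - 1).
  move=> /csP[clA cA Als].
  have [|i [_ [Di _ _]]] := der_split DT (subsetT A); first by rewrite setTD.
  have := opt A d i Als Di; rewrite /attains; case E : (tv S A d) => [//|k] _.
  by rewrite subn1; case: (sS A d k E).
apply/eqP; rewrite eqn_leq; apply/andP; split.
  apply: (der_bigcup_le (m := fun A => tv S A d - 1)) pw _ _ cover DT.
    by move=> A /csP[].
  move=> A j /csP[_ _ Als] /(opt A d j Als); rewrite /attains; case: (tv S A d) => // k.
  by rewrite subn1.
by apply: min_moves_to_le; rewrite cover; apply: der_bigcup.
Qed.
End Correctness.

(** * Reading the instance *)

Fixpoint reads (c : cmd) : bool :=
  match c with
  | Put _ _ _ => false
  | Read _ => true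
  | Seq c1 c2 => reads c1 || reads c2
  | When _ c1 | For _ _ c1 => reads c1
  end.

Lemma den_inp c S : ~~ reads c -> inp (den c S) = inp S.
Proof.
elim: c S => [b e1 e2|x|c1 H1 c2 H2|e c1 H1|x y c1 H1] S //=.
- by rewrite negb_or => /andP[/H1 E1 /H2 E2]; rewrite E2 E1.
- by case: ifP => // _; apply: H1.
move=> nr; apply: (loop_ind (P := fun _ S' => inp S' = inp S)) => // k S' _ <-.
by rewrite H1.
Qed.

(** The exponent is unrolled in the program text, which may depend on the polynomial but not on the
    instance. *)
Fixpoint power (k : nat) : cmd :=
  if k is k'.+1 then power k' ;; multiply else v_acc <~ ENum 0.

Definition prelude (c k : nat) : cmd := header c ;; power k.

Lemma multiply_N S : arr (den multiply S) v_N 0 = arr S v_N 0 * arr S v_n1 0.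
Proof.
rewrite /= /upd2 /=; set f := (X in loop X _ _).
have : forall k, let S' := loop f k (put S v_acc 0 0) in
    arr S' v_acc 0 = arr S v_N 0 * k /\ arr S' v_N 0 = arr S v_N 0.
  move=> k; apply: (loop_ind (P := fun k S' =>
    arr S' v_acc 0 = arr S v_N 0 * k /\ arr S' v_N 0 = arr S v_N 0)).
    by rewrite muln0.
  by move=> i S' _ [accE NE]; rewrite /f /= /upd2 /= accE NE mulnS addnC.
by case/(_ (arr S v_n1 0)).
Qed.

Lemma power_frame k S a i : a \notin [:: v_acc; v_i;
  v_N] -> arr (den (power k) S) a i = arr S a i.
Proof.
move=> aw; elim: k => [|k IHk]; first by rewrite /= upd2_neq //; apply: contraNneq aw => ->.
rewrite -[LHS]/(arr (den multiply (den (power k) S)) a i) den_frame //.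
by move: aw; rewrite !inE; do !case: eqP.
Qed.

Lemma power_N k S : arr (den (power k) S) v_N 0 = arr S v_N 0 * arr S v_n1 0 ^ k.
Proof.
elim: k => [|k IHk]; first by rewrite muln1.
by rewrite -[LHS]/(arr (den multiply (den (power k) S)) v_N 0) multiply_N IHk power_frame //
  -mulnA -expnSr.
Qed.

Lemma power_inp k S : inp (den (power k) S) = inp S.
Proof. by apply: den_inp; elim: k => //= k; rewrite orbF. Qed.

Definition start (s : seq nat) : state := State (fun _ _ => 0) s.

Lemma prelude_ok c k n m s : let S := den (prelude c k) (start (n :: m :: s)) in
  [/\ [/\ arr S v_n 0 = n, arr S v_m 0 = m, arr S v_nm 0 = n + m & arr S v_N 0 = c * n.+1 ^ k],
    inp S = s &
    forall a x, a \in [:: a_nb; a_in; a_L; a_mk; a_T; a_ans; v_cnt] -> arr S a x = 0].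
Proof.
set S0 := start _; cbn zeta; rewrite -[den (prelude c k) S0]/(den (power k) (den (header c) S0)).
split; first by split; rewrite ?power_N ?power_frame //= /upd2 /= ?addn1.
  by rewrite power_inp.
move=> a x ha; rewrite power_frame; last first.
  by move: ha; rewrite !inE; do !case/orP=> [/eqP->//|]; move/eqP->.
by move: ha; rewrite !inE; do !case/orP=> [/eqP->//|]; move/eqP->.
Qed.

(** Treated apart from the rest, because the prelude writes the cells that serve as limits later;
    its own loops all have limit [n + 1]. *)
Lemma bounded_prelude c k n m s B : n < B ->
  bounded B (prelude c k) (start (n :: m :: s)).
Proof.
move=> nB; split; first by [].
apply: bounded_limits => y yl; have -> : y = v_n1.
  by elim: k yl => //= k IHk; rewrite mem_cat inE => /orP[/IHk|/eqP].
split; last by rewrite /= /upd2 /= addn1.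
by elim: k {yl} => //= k IHk; rewrite mem_cat negb_or IHk.
Qed.

Section Reading.
Variables (G : sgraph) (C : finType) (w : {ffun G -> C}) (N : nat).
Implicit Types (A : {set G}) (u v : G) (d e : C) (S : state).

Notation n := #|G|.
Notation m := #|C|.

Lemma fill_pw_ok S : arr S v_n 0 = n ->
  let S' := den fill_pw S in
  arr S' v_pow 0 = 4 ^ n /\ forall i, i < n -> arr S' a_pw i = 4 ^ i.
Proof.
move=> nE; rewrite /= /upd2 /= nE; set f := (X in loop X _ _).
pose P i S' := arr S' v_pow 0 = 4 ^ i /\ forall j, j < i -> arr S' a_pw j = 4 ^ j.
suff : P n (loop f n (put S v_pow 0 1)) by [].
apply: loop_ind => // i S' _ [powE pwE]; rewrite /f {f} /= /upd2 /= powE.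
split=> /=; first by rewrite /upd2 /= expnS; lia.
move=> j; rewrite ltnS leq_eqVlt /= /upd2 /= => /orP[/eqP -> | lt]; first by rewrite eqxx.
by rewrite (ltn_eqF lt) pwE.
Qed.

Lemma fill_de_ok S k : arr S v_nm 0 = k -> let S' := den fill_de S in
  forall i, i < k -> arr S' a_de i = arr S v_pow 0 * i.
Proof.
move=> nE; rewrite /= /upd2 /= nE; set f := (X in loop X _ _).
pose P i S' := [/\ arr S' v_pow 0 = arr S v_pow 0, arr S' v_ev 0 = arr S v_pow 0 * i &
   forall j, j < i -> arr S' a_de j = arr S v_pow 0 * j].
suff [] : P k (loop f k (put S v_ev 0 0)) by [].
apply: loop_ind => [|i S' _ [powE evE deE]]; first by split=> //; rewrite muln0.
rewrite /f {f} /= /upd2 /= powE evE; split=> //=.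
  by rewrite /upd2 /= mulnS addnC.
move=> j; rewrite ltnS leq_eqVlt /= /upd2 /= => /orP[/eqP -> | lt]; first by rewrite eqxx.
by rewrite (ltn_eqF lt) deE.
Qed.

Lemma nth_rk x0 u : nth x0 (enum G) (rk u) = u.
Proof. exact: nth_enum_rank. Qed.

Lemma drop_enum u : drop (rk u) (enum G) = u :: drop (rk u).+1 (enum G).
Proof. by rewrite (drop_nth u) ?nth_rk // -cardE rk_lt. Qed.

Lemma read_adj_ok S rest : env G C N S -> (forall x, arr S a_nb x = 0) ->
  inp S = [seq nat_of_bool (adj u v) | u <- enum G, v <- enum G] ++ rest ->
  let S' := den read_adj S in
  [/\ forall v, arr S' a_nb (idx (@set0 G) (rk v)) = 0,
      forall u v, arr S' a_nb (idx [set u] (rk v)) = adj u v & inp S' = rest].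
Proof.
move=> eS nb0 inpE; rewrite /= (env_n eS); set f := (X in loop X _ _).
pose P i S' := [/\ env G C N S', forall v, arr S' a_nb (idx (@set0 G) (rk v)) = 0,
  forall u v, rk u < i -> arr S' a_nb (idx [set u] (rk v)) = adj u v &
  inp S' = [seq nat_of_bool (adj u v) | u <- drop i (enum G), v <- enum G] ++ rest].
have n0 u : [set u] != set0 by apply/set0Pn; exists u; rewrite set11.
suff [_ H1 H2 H3] : P n (loop f n S).
  split=> //; first by move=> u v; apply: H2; exact: rk_lt.
  by rewrite H3 cardE drop_size.
apply: loop_ind => [|i S' /rkP[u ->] {i} [eS' z' a' i']]; first by split=> //; rewrite drop0.
rewrite /f {f} /= /upd2 /= (env_n eS'); set f := (X in loop X _ _).
pose Q j S' := [/\ env G C N S', arr S' v_u 0 = rk u,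
  forall v, arr S' a_nb (idx (@set0 G) (rk v)) = 0,
  forall u' v, (rk u' < rk u) || (u' == u) && (rk v < j) ->
     arr S' a_nb (idx [set u'] (rk v)) = adj u' v &
  inp S' = [seq nat_of_bool (adj u v) | v <- drop j (enum G)] ++
     [seq nat_of_bool (adj u v) | u <- drop (rk u).+1 (enum G), v <- enum G] ++ rest].
suff [e1 _ H1 H2 H3] : Q n (loop f n (put S' v_u 0 (rk u))).
  split=> //; last by rewrite H3 cardE drop_size.
  move=> u' v; rewrite ltnS leq_eqVlt => /orP[/eqP/rk_inj->|lt]; apply: H2.
    by rewrite eqxx rk_lt orbT.
  by rewrite lt.
apply: loop_ind => [|j S1 /rkP[v ->] {j} [e1 u1 z1 a1 i1]].
  split=> //; first exact: env_put.
    by move=> u' v; rewrite andbF orbF; apply: a'.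
  by rewrite /= i' drop_enum drop0 /= -catA.
rewrite /f {f} /= /upd2 /= u1 i1 drop_enum /= (env_pwE u e1) (env_deV v e1) idxE.
split=> //.
- by apply: env_eq e1 => a x; rewrite !inE; do !case/orP=> [/eqP->//|]; move/eqP->.
- by move=> v'; rewrite /put /= /upd2 /= idx_eq eq_sym (negPf (n0 u)) z1.
move=> u' v'; rewrite /put /= /upd2 /= idx_eq (inj_eq set1_inj) (inj_eq (@rk_inj G)).
have [->|ne] := eqVneq u' u; last by rewrite orbF => lt; apply: a1; rewrite lt.
have [-> //|nev] := eqVneq v' v; rewrite ltnn ltnS leq_eqVlt (inj_eq (@rk_inj G)) (negPf nev) /=.
by move=> lt; apply: a1; rewrite eqxx lt orbT.
Qed.
Lemma read_colours_ok S cs rest : env G C N S -> size cs = m ->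
  (forall x, arr S a_T x = 0) ->
  inp S = cs ++ [seq crk (w v) | v <- enum G] ++ rest ->
  let S' := den read_colours S in
  [/\ sound w S', forall v, attains S' [set v] (w v) 0 & inp S' = rest].
Proof.
move=> eS szc T0 inpE.
rewrite /= (env_m eS); set f1 := (X in loop X m _); set S1 := loop f1 m S.
have {inpE} [e1 T1 i1] : [/\ env G C N S1, forall x, arr S1 a_T x = 0 &
    inp S1 = [seq crk (w v) | v <- enum G] ++ rest].
  pose P i S' := [/\ env G C N S', forall x, arr S' a_T x = 0 &
    inp S' = drop i cs ++ [seq crk (w v) | v <- enum G] ++ rest].
  have [e1 T1 i1] : P m S1; last by split=> //; rewrite i1 drop_oversize // szc.
  apply: loop_ind => [|i S' lti [e' T' i']]; first by split=> //; rewrite drop0.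
  rewrite /f1; split=> //.
    by apply: env_eq e' => a x; rewrite !inE; do !case/orP=> [/eqP->//|]; move/eqP->.
  by rewrite /= i' (drop_nth 0) ?szc.
clearbody S1; rewrite (env_n e1); set f := (X in loop X _ _).
pose P i S' := [/\ env G C N S',
  forall A d k, arr S' a_T (idx A (crk d)) = k.+1 -> exists v, [/\ A = [set v], w v = d & k = 0],
  forall v, rk v < i -> arr S' a_T (idx [set v] (crk (w v))) = 1 &
  inp S' = [seq crk (w v) | v <- drop i (enum G)] ++ rest].
have [_ s' b' i'] : P n (loop f n S1).
  apply: loop_ind => [|i S' /rkP[v ->] {i} [e' s' b' i']].
    by split=> //; [move=> A d k; rewrite T1 | rewrite drop0].
  rewrite /f {f} /= /upd2 /= i' drop_enum /= (env_pwE v e') (env_deC (w v) e') idxE; split=> //.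
  - by apply: env_eq e' => a x; rewrite !inE; do !case/orP=> [/eqP->//|]; move/eqP->.
  - move=> A d k; rewrite /put /= /upd2 /= idx_eq; case: andP => [[/eqP-> /eqP/crk_inj->] [<-]|_].
      by exists v.
    exact: s'.
  move=> u; rewrite /put /= /upd2 /= idx_eq (inj_eq set1_inj).
  case: eqP => [-> | ne]; first by rewrite eqxx.
  by rewrite ltnS leq_eqVlt (inj_eq (@rk_inj G)) => /orP[/eqP/ne//|]; apply: b'.
split.
- move=> A d k /s'[v [-> <- ->]]; split; last exact: Der1.
  by apply/set0Pn; exists v; rewrite set11.
- by move=> v; rewrite /attains /tv b' ?rk_lt.
by rewrite i' cardE drop_size.
Qed.
End Reading.

Definition read_instance : cmd := fill_pw ;; fill_de ;; read_adj ;; read_colours.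

Definition solve : cmd := enumerate ;; optimise ;; collect.

(** [rest] will be the target colour in one problem and empty in the other. *)
Lemma read_instance_ok (I : instance) c k rest :
  let N := (c * (#|graph I|.+1) ^ k) in
  let S' := den read_instance (den (prelude c k) (start (encode I ++ rest))) in
  [/\ env (graph I) (colour I) N S', known (G := graph I) [::] S', sound (colouring I) S',
     forall v, attains S' [set v] (colouring I v) 0 &
     inp S' = rest /\ forall x, arr S' a_ans x = 0].
Proof.
set G := graph I; set C := colour I; set w := colouring I; set n := #|G|; set m := #|C|.
move=> N; cbn zeta.
set adjs := [seq nat_of_bool (adj u v) | u <- enum G, v <- enum G].
set cs := [seq nat_of_ord (enum_rank c) | c <- enum C].
set ws := [seq crk (w v) | v <- enum G].
have encE : encode I ++ rest = n :: m :: adjs ++ cs ++ ws ++ rest.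
  by rewrite /encode /= -!catA.
rewrite encE {encE}; have := prelude_ok c k n m (adjs ++ cs ++ ws ++ rest).
set S1 := den (prelude c k) _; case=> -[n1 m1 nm1 N1] i1 zero1; clearbody S1.
rewrite -[den read_instance S1]/(den read_colours (den read_adj (den fill_de (den fill_pw S1)))).
have [pow2 pw2] := fill_pw_ok n1.
set S2 := den fill_pw S1 in pow2 pw2 *.
have fr2 a x : a \notin [:: v_pow; v_i; a_pw] -> arr S2 a x = arr S1 a x.
  by move=> aw; apply: den_frame; move: aw; rewrite !inE; do !case: eqP.
have i2 : inp S2 = adjs ++ cs ++ ws ++ rest by rewrite den_inp.
have de3 := fill_de_ok (etrans (fr2 v_nm 0 isT) nm1).
set S3 := den fill_de S2 in de3 *.
have fr3 a x : a \notin [:: v_ev; v_i; a_de] -> arr S3 a x = arr S2 a x.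
  by move=> aw; apply: den_frame; move: aw; rewrite !inE; do !case: eqP.
have i3 : inp S3 = adjs ++ cs ++ ws ++ rest by rewrite den_inp.
have e3 : env G C N S3.
  split; rewrite ?fr3 ?fr2 //; first by move=> i lt; rewrite fr3 // pw2.
  by move=> i lt; rewrite de3 // pow2.
have nb3 x : arr S3 a_nb x = 0 by rewrite fr3 // fr2 // zero1.
have [z4 a4 i4] := read_adj_ok e3 nb3 i3.
set S4 := den read_adj S3 in z4 a4 i4 *.
have fr4 a x : a \notin [:: v_u; v_v; v_x; a_nb] -> arr S4 a x = arr S3 a x.
  by move=> aw; apply: den_frame; move: aw; rewrite !inE; do !case: eqP.
have e4 : env G C N S4 by apply: env_den e3.
have szc : size cs = m by rewrite size_map -cardE.
have T4 x : arr S4 a_T x = 0 by rewrite fr4 // fr3 // fr2 // zero1.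
have [s5 b5 i5] := read_colours_ok e4 szc T4 i4.
set S5 := den read_colours S4 in s5 b5 i5 *.
have fr5 a x : a \notin [:: v_i; v_v; v_x; a_T] -> arr S5 a x = arr S4 a x.
  by move=> aw; apply: den_frame; move: aw; rewrite !inE; do !case: eqP.
have nbr0 v : nbr (@set0 G) v = false by apply/existsP => -[x]; rewrite inE.
have nbr1 (u v : G) : nbr [set u] v = adj u v.
  apply/existsP/idP => [[x /andP[/set1P->]]//|uv]; by exists u; rewrite set11.
split=> //; first exact: env_den e4; last first.
  by split=> // x; rewrite fr5 // fr4 // fr3 // fr2 // zero1.
split=> //.
- by rewrite fr5 // fr4 // fr3 // fr2 // zero1.
- by move=> i; rewrite fr5 // fr4 // fr3 // fr2 // zero1 // nth_nil code0.
- by move=> x; rewrite fr5 // fr4 // fr3 // fr2 // zero1.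
- move=> A v [|[u ->]]; last by rewrite fr5 // a4 nbr1; case: (adj u v).
  by rewrite /base_set orbF => /eqP->; rewrite fr5 // z4 nbr0.
move=> A v; rewrite /base_set orbF => /eqP->.
by rewrite fr5 // fr4 // fr3 // fr2 // zero1 // inE.
Qed.

Lemma solve_ok (I : instance) N S :
  #|[set A : {set graph I} | conn A && (A != set0)]| <= N ->
  env (graph I) (colour I) N S -> known (G := graph I) [::] S -> sound (colouring I) S ->
  (forall v, attains S [set v] (colouring I v) 0) -> (forall x, arr S a_ans x = 0) ->
  forall d, arr (den solve S) a_ans (crk d) = min_moves_to (colouring I) d.
Proof.
move=> leN eS kS sS bS aS d.
rewrite -[den solve S]/(den collect (den optimise (den enumerate S))).
have [ls k1 complete] := enumerate_ok leN eS kS.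
have e1 : env (graph I) (colour I) N (den enumerate S) by apply: env_den eS.
have fr1 a x : a \in [:: a_T; a_ans] -> arr (den enumerate S) a x = arr S a x.
  by move=> ha; apply: den_frame; move: ha; rewrite !inE => /orP[] /eqP->.
set S1 := den enumerate S in k1 e1 fr1 *.
have szls : size ls <= N by apply: leq_trans (known_size k1) leN.
have s1 : sound (colouring I) S1 by move=> A e k; rewrite /tv fr1 //; apply: sS.
have b1 v : attains S1 [set v] (colouring I v) 0 by rewrite /attains /tv fr1 //; apply: bS.
have [e2 k2 s2 opt] := optimise_ok szls e1 k1 s1 complete b1.
apply: (collect_ok szls e2 k2 s2 complete opt) => e.
by rewrite den_frame // fr1.
Qed.

(** * The two machines and their running time *)

Definition target_program (c k : nat) : cmd :=
  prelude c k ;; read_instance ;; Read v_tgt ;; solve ;; v_out <~ EGet a_ans (Var v_tgt).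

Definition minimum : cmd :=
  v_out <~ EGet a_ans (ENum 0) ;;
  For v_d v_m (When (Var v_out -: EGet a_ans (Var v_d)) (v_out <~ EGet a_ans (Var v_d))).

Definition any_program (c k : nat) : cmd := prelude c k ;; read_instance ;; solve ;; minimum.

Lemma wf_prelude c k : wf (prelude c k).
Proof. by rewrite /=; elim: k => //= k ->. Qed.

Lemma target_program_ok (J : target_instance) c k :
  #|[set A : {set graph J} | conn A && (A != set0)]| <= c * #|graph J|.+1 ^ k ->
  arr (den (target_program c k) (start (encode_target J))) v_out 0 = m_target J.
Proof.
move=> leN; have := read_instance_ok J c k [:: crk (target J)].
rewrite -[den (target_program c k) _]/(den (v_out <~ EGet a_ans (Var v_tgt)) (den solve
  (den (Read v_tgt) (den read_instance (den (prelude c k) (start (encode_target J))))))).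
rewrite -/(encode_target J); set S1 := den read_instance _; case=> e1 k1 s1 b1 [i1 a1].
set S2 := den (Read v_tgt) S1.
have fr2 a x : a != v_tgt -> arr S2 a x = arr S1 a x by move=> ne; rewrite den_frame // inE.
have t2 : arr S2 v_tgt 0 = crk (target J) by rewrite /= /upd2 /= i1.
have H := @solve_ok J (c * #|graph J|.+1 ^ k) S2 leN.
rewrite -[LHS]/(arr (den solve S2) a_ans (arr (den solve S2) v_tgt 0)).
rewrite [X in arr _ a_ans X]den_frame // t2; apply: H.
- by apply: env_den e1.
- by apply: known_eq k1 => a x ak; apply: fr2; apply: contraTneq ak => ->.
- by move=> A d j; rewrite /tv fr2 //; apply: s1.
- by move=> v; rewrite /attains /tv fr2 //; apply: b1.
by move=> x; rewrite fr2 ?a1.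
Qed.

Lemma minimum_ok (S : state) (m : nat) : arr S v_m 0 = m -> 0 < m ->
  let r := arr (den minimum S) v_out 0 in
  (exists2 i, i < m & r = arr S a_ans i) /\ forall i, i < m -> r <= arr S a_ans i.
Proof.
move=> mE m_gt0; rewrite /= /upd2 /= mE; set f := (X in loop X _ _).
set S1 := put _ _ _ _.
pose P j S' := [/\ forall i, arr S' a_ans i = arr S a_ans i,
  exists2 i, i < m & arr S' v_out 0 = arr S a_ans i &
  forall i, i < j -> arr S' v_out 0 <= arr S a_ans i].
suff [_ H1 H2] : P m (loop f m S1) by [].
apply: loop_ind => [|j S' ltj [ansE outE le]]; first by split=> //; exists 0.
rewrite /f {f} /= /upd2 /= !ansE subn_gt0; case: ltnP => cmp; split=> //.
- by exists j.
- move=> i; rewrite ltnS leq_eqVlt /= /upd2 /= => /orP[/eqP->//|/le]; apply: leq_trans.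
  exact: ltnW.
by move=> i; rewrite ltnS leq_eqVlt => /orP[/eqP->//|/le].
Qed.

Lemma any_program_ok (I : instance) c k :
  #|[set A : {set graph I} | conn A && (A != set0)]| <= c * #|graph I|.+1 ^ k ->
  arr (den (any_program c k) (start (encode I))) v_out 0 = m_any I.
Proof.
move=> leN; have := read_instance_ok I c k [::]; rewrite cats0.
rewrite -[den (any_program c k) _]/(den minimum (den solve
  (den read_instance (den (prelude c k) (start (encode I)))))).
set S1 := den read_instance _; case=> e1 k1 s1 b1 [i1 a1].
have ansE := solve_ok leN e1 k1 s1 b1 a1.
have e2 : env (graph I) (colour I) (c * #|graph I|.+1 ^ k) (den solve S1) by apply: env_den e1.
have [[i lti rE] min] := minimum_ok (env_m e2) (colour_gt0 I).
move: rE min; set r := arr _ v_out 0 => rE min.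
rewrite /m_any /min_moves; case: ex_minnP => q /existsP[d /eqP qE] minq.
apply/eqP; rewrite eqn_leq; apply/andP; split.
  by rewrite -qE -ansE; apply: min; exact: crk_lt.
apply: minq; have [e ie] := crkP lti.
by apply/existsP; exists e; rewrite rE ie ansE.
Qed.

Lemma leq_size_input_size s : size s <= input_size s.
Proof.
by rewrite /input_size -sum1_size; elim: s => [|a s IHs]; rewrite ?big_nil // !big_cons leq_add.
Qed.

(** Memory cell 0, where the machine leaves its answer, is entry 0 of array 0, that is [v_out]. *)
Lemma poly_time_of_cmd (X : Type) (enc : X -> seq nat) (dom : X -> bool) (f : X -> nat)
    (c : cmd) (b : {poly nat}) : wf c ->
  (forall x, dom x -> bounded b.[input_size (enc x)]%R c (start (enc x)) /\
     arr (den c (start (enc x))) 0 0 = f x) ->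
  poly_time_computable enc dom f.
Proof.
move=> wfc H; exists (ccmd 0 0 c), (time c b) => x /H[bc fE].
have R0 : represents (fun => 0) (start (enc x)) by [].
have [t [M [E R _ T]]] := ccmd_ok wfc [::] [::] 0 bc R0.
rewrite cats0 /= in E; exists t; rewrite /init E /halted /= leqnn; split=> //.
by rewrite -fE -R.
Qed.

(** * Polynomial bounds *)

Import Order.TTheory GRing.Theory Num.Theory.

(** By induction on [p]: a factor [n] is absorbed by raising [k], and the constant term by adding to
    [c] a natural number above its absolute value, which the archimedean property provides. The base
    [n.+1] keeps all powers positive. *)
Lemma poly_nat_bound (R : archiRealDomainType) (p : {poly R}) :
  exists c k, forall n : nat, (p.[n%:R] <= (c * n.+1 ^ k)%N%:R)%R.
Proof.
elim/poly_ind: p => [|p a [c [k H]]].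
  by exists 0, 0 => n; rewrite horner0 ler0n.
have le_a : (a <= (Num.bound `|a|)%:R)%R.
  by apply: le_trans (ler_norm a) (ltW (archi_boundP (normr_ge0 a))).
exists (c + Num.bound `|a|%R), k.+1 => n; rewrite hornerMXaddC.
have le1 : (p.[n%:R] * n%:R <= ((c * n.+1 ^ k) * n)%N%:R)%R by rewrite natrM ler_wpM2r ?ler0n.
apply: le_trans (lerD le1 le_a) _; rewrite -natrD ler_nat expnS.
have : 0 < n.+1 ^ k by rewrite expn_gt0.
move: (Num.bound _) (n.+1 ^ k) => u v; nia.
Qed.

Lemma conn_bound (R : archiRealDomainType) (p : {poly R}) :
  exists c k, forall G : sgraph, in_Gp p G ->
    #|[set A : {set G} | conn A && (A != set0)]| <= c * #|G|.+1 ^ k.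
Proof.
have [c [k H]] := poly_nat_bound p; exists c, k => G inG.
apply: leq_trans (card_conn G) _; rewrite -(ler_nat R).
exact: le_trans inG (H _).
Qed.

(** At input size [s], the first term dominates [N], and [s + 1] dominates [n], [m], [n + m] and
    [n + 1]. *)
Definition loop_bound (c k : nat) : {poly nat} :=
  (c%:P * ('X + 1) ^+ k + 'X + 1)%R.

Lemma loop_boundE c k s : (loop_bound c k).[s]%R = c * s.+1 ^ k + s + 1.
Proof.
rewrite /loop_bound !hornerE; congr (_ * _ + _ + _).
elim: k => [|k IHk]; first by rewrite expr0.
by rewrite exprS expnS IHk -[(s + 1)%R]/(s + 1)%N addn1.
Qed.

Definition sizes : seq nat := [:: v_n; v_m; v_nm; v_N].

Lemma bounded_body c k n m s (body : cmd) :
  all (fun y => y \in sizes) (limits body) -> all (fun y => y \notin writes body) sizes ->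
  n + m < input_size (n :: m :: s) ->
  bounded (loop_bound c k).[input_size (n :: m :: s)]%R (prelude c k ;; body)
    (start (n :: m :: s)).
Proof.
move=> lim wr lts; rewrite loop_boundE; move: (input_size _) lts => B lts.
split; first by apply: bounded_prelude; lia.
have [[nE mE nmE NE] _ _] := prelude_ok c k n m s; move: (den _ _) nE mE nmE NE => S nE mE nmE NE.
have leN : c * n.+1 ^ k <= c * B.+1 ^ k.
  by rewrite leq_mul2l; apply/orP; right; case: k {NE} => // k; rewrite leq_exp2r //; lia.
apply: bounded_limits => y yl; have ys := allP lim y yl; split; first exact: (allP wr).
by move: ys; rewrite !inE => /or4P[] /eqP->; rewrite ?nE ?mE ?nmE ?NE; lia.
Qed.

(** The listing of the colour-set and the colours of the vertices already take
    [#|colour I| + #|graph I|] words, each of at least one digit. *)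
Lemma encode_size (I : instance) rest :
  #|graph I| + #|colour I| < input_size (encode I ++ rest).
Proof.
apply: leq_trans (leq_size_input_size _);
  rewrite /encode !size_cat (size_map _ (enum (colour I))) (size_map _ (enum (graph I))) -!cardE
    /=.
by move: (size _) => u; lia.
Qed.

Theorem theorem4p1 (R : archiRealDomainType) (p : {poly R}) :
  poly_time_computable encode_target
    (fun J : target_instance => in_Gp p (graph J)) m_target /\
  poly_time_computable encode
    (fun I : instance => in_Gp p (graph I)) m_any.
Proof.
have [c [k connN]] := conn_bound p; split.
  apply: (poly_time_of_cmd (c := target_program c k) (b := loop_bound c k)).
    by apply/andP; split; first exact: wf_prelude.
  move=> J /connN le; split; last exact: target_program_ok.
  (* The conditions on limits and writes concern a fixed program text and hold by computation. *)
  by apply: bounded_body => //; apply: (encode_size J).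
apply: (poly_time_of_cmd (c := any_program c k) (b := loop_bound c k)).
  by apply/andP; split; first exact: wf_prelude.
move=> I /connN le; split; last exact: any_program_ok.
by apply: bounded_body => //; rewrite -[_ :: _]cats0; apply: (encode_size I).
Qed.
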